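(* There exist localisable measure spaces $(\Omega_1,\mu_1)$, $(\Omega_2,\mu_2)$ and an operator space $Z$ with complete isometries $Z\hookrightarrow X:=\operatorname{MIN}(L^\infty(\Omega_1,\mu_1))$ and $Z\hookrightarrow Y:=\operatorname{MIN}(L^\infty(\Omega_2,\mu_2))$ such that the amalgamated $\ell_\infty$-direct sum $(X\oplus_Z Y)_\infty$ is not completely isomorphic to any minimal operator space.
   Context: All spaces are complex; an operator space is a closed subspace of some $B(\mathcal H)$ with the induced norms on matrix spaces $M_n(X)$. An operator space $X$ is minimal if for every operator space $Y$ every contraction $T:Y\to X$ is a complete contraction. For a Banach space $E$, $\operatorname{MIN}(E)$ denotes $E$ with its (unique) minimal operator space structure. The $\ell_\infty$-direct sum $X\oplus_\infty Y$ has matrix norms $\|(x,y)\|_{M_n(X\oplus_\infty Y)}=\max(\|x\|_{M_n(X)},\|y\|_{M_n(Y)})$. If $Z$ is a common subspace of $X$ and $Y$ (i.e. complete isometries $Z\hookrightarrow X$, $Z\hookrightarrow Y$ are given), the amalgamated $\ell_\infty$-direct sum is the quotient operator space $(X\oplus_Z Y)_\infty:=(X\oplus_\infty Y)/\overline{\operatorname{span}}\{(z,-z):z\in Z\}$. Two operator spaces are completely isomorphic if there is a linear bijection between them that is completely bounded with completely bounded inverse. *)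

(* Defs.v *)
From HB Require Import structures.
From mathcomp Require Import all_boot all_order all_algebra.
From mathcomp Require Import generic_quotient sesquilinear complex.
From mathcomp Require Import all_classical all_reals all_analysis.
From mathcomp Require Import measurable_realfun ess_sup_inf.

Set Implicit Arguments.
Unset Strict Implicit.
Unset Printing Implicit Defensive.

Import Order.TTheory GRing.Theory Num.Def Num.Theory.
Import numFieldNormedType.Exports.
Local Open Scope classical_set_scope.
Local Open Scope complex_scope.
Local Open Scope ring_scope.

Definition is_submodule (K : pzRingType) (V : lmodType K) (N : set V) : Prop :=
  [/\ N 0, forall x y, N x -> N y -> N (x + y) &
      forall (a : K) x, N x -> N (a *: x)].

Record submodule (K : pzRingType) (V : lmodType K) := Submodule {
  submodule_set :> V -> Prop;
  submoduleP : is_submodule submodule_set }.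

Section quotient_module.
Context {K : pzRingType} {V : lmodType K} (N : submodule V).

Let eqmodN (x y : V) : bool := `[< N (x - y) >].

Let N0 : N 0. Proof. by case: (submoduleP N). Qed.
Let ND x y : N x -> N y -> N (x + y).
Proof. by case: (submoduleP N) => _ + _; exact. Qed.
Let NZ a x : N x -> N (a *: x).
Proof. by case: (submoduleP N) => _ _; exact. Qed.
Let NN x : N x -> N (- x). Proof. by rewrite -scaleN1r; exact: NZ. Qed.

Let eqmodN_refl : reflexive eqmodN.
Proof. by move=> x; apply/asboolP; rewrite subrr. Qed.
Let eqmodN_sym : symmetric eqmodN.
Proof.
by move=> x y; apply/idP/idP => /asboolP h; apply/asboolP;
  rewrite -opprB; exact: NN.
Qed.
Let eqmodN_trans : transitive eqmodN.
Proof.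
move=> y x z /asboolP xy /asboolP yz; apply/asboolP.
by rewrite -(subrKA y); exact: ND.
Qed.

Canonical eqmodN_equiv := EquivRel eqmodN eqmodN_refl eqmodN_sym eqmodN_trans.

Definition quotient : Type := {eq_quot eqmodN}%qT.
HB.instance Definition _ := Choice.on quotient.
HB.instance Definition _ := EqQuotient.on quotient.

Definition quotient_pi (x : V) : quotient := (\pi_quotient x)%qT.

Lemma quotient_piP x y : quotient_pi x = quotient_pi y <-> N (x - y).
Proof.
split=> [/eqP|h]; first by rewrite /quotient_pi eqmodE => /asboolP.
by apply/eqP; rewrite /quotient_pi eqmodE; apply/asboolP.
Qed.

Lemma quotient_reprK (q : quotient) : quotient_pi (repr q) = q.
Proof. exact: reprK. Qed.

Lemma quotient_repr x : N (repr (quotient_pi x) - x).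
Proof. by apply/quotient_piP; rewrite quotient_reprK. Qed.

Let zero : quotient := quotient_pi 0.
Let add (p q : quotient) : quotient := quotient_pi (repr p + repr q).
Let opp (p : quotient) : quotient := quotient_pi (- repr p).
Let scale (a : K) (p : quotient) : quotient := quotient_pi (a *: repr p).

Let addE x y : add (quotient_pi x) (quotient_pi y) = quotient_pi (x + y).
Proof.
by apply/quotient_piP; rewrite opprD addrACA; apply: ND; exact: quotient_repr.
Qed.
Let oppE x : opp (quotient_pi x) = quotient_pi (- x).
Proof.
by apply/quotient_piP; rewrite -opprD; apply: NN; exact: quotient_repr.
Qed.
Let scaleE a x : scale a (quotient_pi x) = quotient_pi (a *: x).
Proof.
by apply/quotient_piP; rewrite -scalerBr; apply: NZ; exact: quotient_repr.
Qed.

Let piW (P : quotient -> Prop) : (forall x, P (quotient_pi x)) -> forall q, P q.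
Proof. by move=> h q; rewrite -(quotient_reprK q). Qed.

Let addA : associative add.
Proof.
by elim/piW => x; elim/piW => y; elim/piW => z; rewrite !addE addrA.
Qed.
Let addC : commutative add.
Proof. by elim/piW => x; elim/piW => y; rewrite !addE addrC. Qed.
Let add0 : left_id zero add.
Proof. by elim/piW => x; rewrite addE add0r. Qed.
Let addN : left_inverse zero opp add.
Proof. by elim/piW => x; rewrite oppE addE addNr. Qed.
HB.instance Definition _ := GRing.isZmodule.Build quotient addA addC add0 addN.

Let scaleA a b q : scale a (scale b q) = scale (a * b) q.
Proof. by elim/piW: q => x; rewrite !scaleE scalerA. Qed.
Let scale1 : left_id 1 scale.
Proof. by elim/piW => x; rewrite scaleE scale1r. Qed.
Let scaleDr : right_distributive scale +%R.
Proof.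
move=> a; elim/piW => x; elim/piW => y.
by rewrite [_ + _]addE !scaleE [RHS]addE scalerDr.
Qed.
Let scaleDl q : {morph scale^~ q : a b / a + b}.
Proof.
by move=> a b; elim/piW: q => x; rewrite !scaleE [RHS]addE scalerDl.
Qed.
HB.instance Definition _ := GRing.Zmodule_isLmodule.Build K quotient
  scaleA scale1 scaleDr scaleDl.

Lemma quotient_pi_is_linear : linear quotient_pi.
Proof. by move=> a x y; rewrite -addE -scaleE. Qed.
HB.instance Definition _ :=
  GRing.isLinear.Build K V quotient _ quotient_pi quotient_pi_is_linear.

End quotient_module.

Definition hilbert (R : realType) (H : completeNormedModType R[i])
    (ip : {dot H for conjC}) : Prop :=
  forall h : H, `|h| ^+ 2 = ip h h.

Definition bounded_operator (R : realType) (H : normedModType R[i])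
    (T : H -> H) : Prop :=
  linear T /\ exists C : R[i], forall h, `|T h| <= C * `|h|.

(* The norm of the Hilbert space H^n; [`|h|] lives in R[i], whence [Re]. *)
Definition l2norm (R : realType) (H : normedModType R[i]) n
    (h : 'I_n -> H) : R :=
  Num.sqrt (\sum_i (complex.Re `|h i|) ^+ 2).

(* The norm of M_n(B(H)) = B(H^n). *)
Definition opnorm (R : realType) (H : normedModType R[i]) n
    (T : 'M[H -> H]_n) : R :=
  sup [set l2norm (fun i => \sum_j T i j (h j)) |
       h in [set h : 'I_n -> H | l2norm h <= 1]].

Definition matrix_norms (R : realType) (E : lmodType R[i]) : Type :=
  forall n : nat, 'M[E]_n -> R.

(* [m] makes the normed space E an operator space: E is, via the embedding J,
   a closed subspace of B(H), with the induced matrix norms, and the norm of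
   M_1(E) = E is the given one. *)
Definition operator_space (R : realType) (E : normedModType R[i])
    (m : matrix_norms E) : Prop :=
  (forall x : E, `|x| = (m 1 (const_mx x))%:C) /\
  exists (H : completeNormedModType R[i]) (ip : {dot H for conjC})
         (J : {linear E -> (H -> H)}),
    [/\ hilbert ip,
        forall x, bounded_operator (J x),
        injective J,
        forall T : H -> H, bounded_operator T ->
          (forall e : R, 0 < e -> exists x : E,
            opnorm (const_mx (T - J x) : 'M[H -> H]_1) < e) ->
          exists x : E, T = J x &
        forall n (x : 'M[E]_n), m n x = opnorm (map_mx J x)].

Definition completely_bounded (R : realType) (E F : lmodType R[i])
    (mE : matrix_norms E) (mF : matrix_norms F) (f : {linear E -> F}) : Prop :=
  exists C : R, forall n (x : 'M[E]_n), mF n (map_mx f x) <= C * mE n x.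

Definition complete_contraction (R : realType) (E F : lmodType R[i])
    (mE : matrix_norms E) (mF : matrix_norms F) (f : {linear E -> F}) : Prop :=
  forall n (x : 'M[E]_n), mF n (map_mx f x) <= mE n x.

Definition complete_isometry (R : realType) (E F : lmodType R[i])
    (mE : matrix_norms E) (mF : matrix_norms F) (f : {linear E -> F}) : Prop :=
  forall n (x : 'M[E]_n), mF n (map_mx f x) = mE n x.

Definition completely_isomorphic (R : realType) (E F : lmodType R[i])
    (mE : matrix_norms E) (mF : matrix_norms F) : Prop :=
  exists (f : {linear E -> F}) (g : {linear F -> E}),
    [/\ cancel f g, cancel g f,
        completely_bounded mE mF f & completely_bounded mF mE g].

(* [minimal_operator_space m], for [m : matrix_norms E], says that (E, m) is
   MIN(E); see [minimal_operator_space_uniq]. *)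
Definition minimal_operator_space (R : realType) (E : normedModType R[i])
    (m : matrix_norms E) : Prop :=
  operator_space m /\
  forall (F : normedModType R[i]) (mF : matrix_norms F), operator_space mF ->
  forall f : {linear F -> E}, (forall y, `|f y| <= `|y|) ->
  complete_contraction mF m f.

Lemma minimal_operator_space_uniq (R : realType) (E : normedModType R[i])
    (m1 m2 : matrix_norms E) :
  minimal_operator_space m1 -> minimal_operator_space m2 ->
  forall n (x : 'M[E]_n), m1 n x = m2 n x.
Proof.
move=> -[m1_os m1_min] [m2_os m2_min] n x; apply/le_anti/andP.
have idE : map_mx (idfun : {linear E -> E}) x = x.
  by apply/matrixP => i j; rewrite mxE.
split.
  by have := m1_min E m2 m2_os idfun (fun y => lexx _) n x; rewrite idE.
by have := m2_min E m1 m1_os idfun (fun y => lexx _) n x; rewrite idE.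
Qed.

Definition oplus_norms (R : realType) (E F : lmodType R[i])
    (mE : matrix_norms E) (mF : matrix_norms F) : matrix_norms (E * F)%type :=
  fun n p => Num.max (mE n (map_mx fst p)) (mF n (map_mx snd p)).

Definition quotient_norms (R : realType) (E : lmodType R[i])
    (m : matrix_norms E) (N : submodule E) : matrix_norms (quotient N) :=
  fun n q => inf [set m n x | x in
                  [set x : 'M[E]_n | map_mx (quotient_pi N) x = q]].
Arguments quotient_norms {R E} m N n q.

Definition linear_span (K : pzRingType) (V : lmodType K) (A : set V) : set V :=
  smallest (@is_submodule K V) A.

Lemma linear_span_is_submodule (K : pzRingType) (V : lmodType K) (A : set V) :
  is_submodule (linear_span A).
Proof.
split=> [B [[B0 _ _] _]//|x y sx sy B BA|a x sx B BA].
  by case: (BA) => -[_ BD _] _; apply: BD; [exact: sx|exact: sy].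
by case: (BA) => -[_ _ BZ] _; apply: BZ; exact: sx.
Qed.

Lemma closure_is_submodule (K : numFieldType) (V : normedModType K)
    (A : set V) : is_submodule A -> is_submodule (closure A).
Proof.
move=> [A0 AD AZ]; split.
- exact: subset_closure.
- move=> x y cx cy B /= nB.
  have /= [[P Q] /= [nP nQ] PQB] := @add_continuous V (x, y) B nB.
  have [u [Au Pu]] := cx _ nP; have [v [Av Qv]] := cy _ nQ.
  by exists (u + v); split; [exact: AD|exact: (PQB (u, v))].
- move=> a x cx B nB.
  have [u [Au Bu]] := cx _ (scaler_continuous nB).
  by exists (a *: u); split; [exact: AZ|].
Qed.

Section amalgamated_sum.
Context {R : realType} {X Y : normedModType R[i]} {Z : lmodType R[i]}.
Variables (i : Z -> X) (j : Z -> Y).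

(* The closure is taken in the library topology of X * Y (max norm), which is
   the one of M_1(X (+)_oo Y). *)
Definition amalgam_kernel : submodule (X * Y)%type :=
  Submodule (closure_is_submodule
    (linear_span_is_submodule [set (i z, - j z) | z in [set: Z]])).

Definition amalgam : lmodType R[i] := quotient amalgam_kernel.

Definition amalgam_norms (mX : matrix_norms X) (mY : matrix_norms Y) :
    matrix_norms amalgam :=
  quotient_norms (oplus_norms mX mY) amalgam_kernel.

End amalgamated_sum.
Arguments amalgam_norms {R X Y Z} i j mX mY n q.

Section localisable.
Context {R : realType} {d : measure_display} {T : measurableType d}.
Variable mu : {measure set T -> \bar R}.

Definition semifinite : Prop :=
  forall A, measurable A -> mu A = +oo%E ->
  exists B, [/\ measurable B, B `<=` A, (0 < mu B)%E & (mu B < +oo)%E].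

Definition essential_supremum (F : set (set T)) (H : set T) : Prop :=
  [/\ measurable H, forall A, F A -> mu (A `\` H) = 0%E &
      forall G, measurable G -> (forall A, F A -> mu (A `\` G) = 0%E) ->
        mu (H `\` G) = 0%E].

(* In the sense of Fremlin: semifinite, and the measure algebra is complete. *)
Definition localisable : Prop :=
  semifinite /\
  forall F : set (set T), F `<=` measurable -> exists H, essential_supremum F H.

End localisable.

Section Linf.
Context {R : realType} {d : measure_display} {T : measurableType d}.
Variable mu : {measure set T -> \bar R}.

(* [Lnorm mu +oo] is the essential supremum, and 0 when [mu setT = 0]. *)
Definition Linf_enorm (f : T -> R[i]) : \bar R :=
  Lnorm mu +oo (fun x => (complex.Re `|f x|)%:E).

(* Measurability for the Borel sigma-algebra of C = R^2. *)
Definition ess_bounded (f : T -> R[i]) : Prop :=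
  [/\ measurable_fun [set: T] (fun x => complex.Re (f x) : measurableTypeR R),
      measurable_fun [set: T] (fun x => complex.Im (f x) : measurableTypeR R) &
      (Linf_enorm f < +oo)%E].

Let ReNormE (v : R[i]) :
  `|v| = (complex.Re `|v|)%:C.
Proof.
by rewrite normc_def.
Qed.

Let abs0 : complex.Re `|0 : R[i]| = 0.
Proof. by rewrite normr0. Qed.

Let abs_ge0 (z : R[i]) : 0 <= complex.Re `|z|.
Proof. by rewrite -lecR -ReNormE normr_ge0. Qed.

Let absD (z w : R[i]) :
  complex.Re `|z + w| <= complex.Re `|z| + complex.Re `|w|.
Proof. by rewrite -lecR rmorphD /= -!ReNormE ler_normD. Qed.

Let absM (z w : R[i]) :
  complex.Re `|z * w| = complex.Re `|z| * complex.Re `|w|.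
Proof. by apply: complexI; rewrite rmorphM /= -!ReNormE normrM. Qed.

Let ReM (z w : R[i]) : complex.Re (z * w) =
  complex.Re z * complex.Re w - complex.Im z * complex.Im w.
Proof. by case: z w => ? ? []. Qed.

Let ImM (z w : R[i]) : complex.Im (z * w) =
  complex.Re z * complex.Im w + complex.Im z * complex.Re w.
Proof. by case: z w => ? ? []. Qed.

Let enorm_leP (f : T -> R[i]) (c : R) : 0 <= c ->
  (Linf_enorm f <= c%:E)%E <-> {ae mu, forall x, complex.Re `|f x| <= c}.
Proof.
move=> c0; rewrite /Linf_enorm unlock; case: ifPn => mu0.
  split=> [/ess_supP|h]; last (apply/ess_supP; move: h);
    apply: filterS => x /=; by rewrite ger0_norm ?abs_ge0// lee_fin.
split=> // _; exists setT; split => //.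
by apply/eqP; rewrite eq_le measure_ge0 andbT leNgt.
Qed.

Let fnorm (f : T -> R[i]) : R := fine (Linf_enorm f).

Let enormE f : ess_bounded f -> Linf_enorm f = (fnorm f)%:E.
Proof.
move=> [_ _ foo]; rewrite /fnorm fineK// ge0_fin_numE//; exact: Lnorm_ge0.
Qed.

Let fnorm_ge0 f : 0 <= fnorm f.
Proof. by apply: fine_ge0; exact: Lnorm_ge0. Qed.

Let ae_fnorm f : ess_bounded f ->
  {ae mu, forall x, complex.Re `|f x| <= fnorm f}.
Proof.
by move=> bf; apply/(enorm_leP _ (fnorm_ge0 f)); rewrite enormE.
Qed.

Let ess_boundedI (f : T -> R[i]) (c : R) : 0 <= c ->
  measurable_fun [set: T] (fun x => complex.Re (f x) : measurableTypeR R) ->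
  measurable_fun [set: T] (fun x => complex.Im (f x) : measurableTypeR R) ->
  {ae mu, forall x, complex.Re `|f x| <= c} ->
  ess_bounded f /\ fnorm f <= c.
Proof.
move=> c0 mr mi /(enorm_leP _ c0) h.
have bf : ess_bounded f by split=> //; apply: le_lt_trans h _; exact: ltry.
by split=> //; rewrite -lee_fin -enormE.
Qed.

Let bounded0 : ess_bounded 0.
Proof.
have [] // := @ess_boundedI 0 0 (lexx _); try exact: measurable_cst.
by apply: aeW => x; rewrite -[0 x]/(0 : R[i]) abs0.
Qed.

Let boundedD f g : ess_bounded f -> ess_bounded g ->
  ess_bounded (f + g) /\ fnorm (f + g) <= fnorm f + fnorm g.
Proof.
move=> bf bg; have [fr fi _] := bf; have [gr gi _] := bg.
apply: ess_boundedI; first by rewrite addr_ge0.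
- apply: eq_measurable_fun (measurable_funD fr gr) => x _ /=.
  by rewrite raddfD.
- apply: eq_measurable_fun (measurable_funD fi gi) => x _ /=.
  by rewrite raddfD.
- have := ae_fnorm bf; have := ae_fnorm bg; apply: filterS2 => x hg hf.
  by apply: le_trans (absD _ _) _; exact: lerD.
Qed.

Let boundedZ (a : R[i]) f : ess_bounded f ->
  ess_bounded (a *: f) /\ fnorm (a *: f) <= complex.Re `|a| * fnorm f.
Proof.
move=> bf; have [fr fi _] := bf.
apply: ess_boundedI; first by rewrite mulr_ge0// abs_ge0.
- apply: eq_measurable_fun (measurable_funB
    (measurable_funM (measurable_cst (complex.Re a)) fr)
    (measurable_funM (measurable_cst (complex.Im a)) fi)) => x _.
  by rewrite -[(a *: f) x]/(a * f x) ReM.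
- apply: eq_measurable_fun (measurable_funD
    (measurable_funM (measurable_cst (complex.Re a)) fi)
    (measurable_funM (measurable_cst (complex.Im a)) fr)) => x _.
  by rewrite -[(a *: f) x]/(a * f x) ImM.
- have := ae_fnorm bf; apply: filterS => x hf.
  by rewrite [complex.Re _]absM ler_wpM2l ?abs_ge0.
Qed.

Definition ess_bounded_pred : {pred T -> R[i]} := [pred f | `[< ess_bounded f >]].

Let ess_bounded_submod_closed : submod_closed ess_bounded_pred.
Proof.
split=> [|a f g]; first exact/asboolP.
move=> /asboolP bf /asboolP bg; apply/asboolP.
by have [] := boundedD (proj1 (boundedZ a bf)) bg.
Qed.
HB.instance Definition _ :=
  GRing.isSubmodClosed.Build _ _ ess_bounded_pred ess_bounded_submod_closed.

Record ess_bounded_fun := EssBoundedFun {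
  ess_bounded_val :> T -> R[i];
  _ : ess_bounded_val \in ess_bounded_pred }.
HB.instance Definition _ := [isSub for ess_bounded_val].
HB.instance Definition _ := [Choice of ess_bounded_fun by <:].
HB.instance Definition _ := [SubChoice_isSubLmodule of ess_bounded_fun by <:].

Let ess_bounded_funP (f : ess_bounded_fun) : ess_bounded f.
Proof. by apply/asboolP; exact: (valP f). Qed.

Definition null_fun (f : ess_bounded_fun) : Prop := {ae mu, forall x, f x = 0}.

Let null_fun_submodule : is_submodule null_fun.
Proof.
split=> [|f g|a f].
- exact: aeW.
- by apply: filterS2 => x /= f0 g0; rewrite fctE f0 g0 addr0.
- by apply: filterS => x /= f0; rewrite fctE f0 scaler0.
Qed.

Definition Linf : Type := quotient (Submodule null_fun_submodule).
HB.instance Definition _ := GRing.Lmodule.on Linf.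

Definition Linf_pi : ess_bounded_fun -> Linf := quotient_pi _.
HB.instance Definition _ := @GRing.isLinear.Build R[i] ess_bounded_fun Linf _
  Linf_pi (@quotient_pi_is_linear _ _ (Submodule null_fun_submodule)).

Let Linf_piW (P : Linf -> Prop) : (forall f, P (Linf_pi f)) -> forall q, P q.
Proof. by move=> h q; rewrite -(quotient_reprK q); exact: h. Qed.

Definition Linf_norm (q : Linf) : R :=
  fine (Linf_enorm (ess_bounded_val (repr q))).

Let fnorm_le (f g : ess_bounded_fun) : null_fun (f - g) -> fnorm f <= fnorm g.
Proof.
move=> fg; have [fr fi _] := ess_bounded_funP f.
apply: (proj2 (ess_boundedI (fnorm_ge0 g) fr fi _)).
have := ae_fnorm (ess_bounded_funP g); apply: filterS2 fg => x /=.
by move=> fgx; rewrite (subr0_eq (fgx : f x - g x = 0)).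
Qed.

Lemma Linf_norm_pi f : Linf_norm (Linf_pi f) = fine (Linf_enorm f).
Proof.
apply/le_anti/andP; split; apply: fnorm_le;
    apply: (proj1 (quotient_piP (Submodule null_fun_submodule) _ _)).
  exact: quotient_reprK.
by rewrite [RHS]quotient_reprK.
Qed.

Let Linf_normD (p q : Linf) :
  (Linf_norm (p + q))%:C <= (Linf_norm p)%:C + (Linf_norm q)%:C.
Proof.
elim/Linf_piW: p => f; elim/Linf_piW: q => g.
rewrite -rmorphD /= lecR -linearD.
rewrite !Linf_norm_pi.
exact: (proj2 (boundedD (ess_bounded_funP f) (ess_bounded_funP g))).
Qed.

Let Linf_normZ (a : R[i]) (p : Linf) :
  (Linf_norm (a *: p))%:C = `|a| * (Linf_norm p)%:C.
Proof.
elim/Linf_piW: p => f.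
rewrite (ReNormE a) -rmorphM /= -linearZ.
rewrite !Linf_norm_pi; congr (_%:C).
have bf := ess_bounded_funP f.
apply/le_anti/andP; split; first exact: (proj2 (boundedZ a bf)).
have [->|a0] := eqVneq a 0; first by rewrite Normc.normc0 mul0r; exact: fnorm_ge0.
have := proj2 (boundedZ a^-1 (proj1 (boundedZ a bf))).
rewrite scalerA mulVf// scale1r => h.
apply: le_trans (ler_wpM2l (abs_ge0 a) h) _.
by rewrite mulrA -absM mulfV// normr1 mul1r.
Qed.

Let Linf_norm_eq0 (p : Linf) : (Linf_norm p)%:C = 0 -> p = 0.
Proof.
elim/Linf_piW: p => f /(@complexI R) h.
rewrite -[RHS](linear0 Linf_pi).
apply: (proj2 (quotient_piP (Submodule null_fun_submodule) _ _)).
rewrite subr0.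
have := ae_fnorm (ess_bounded_funP f).
apply: filterS => x; rewrite /fnorm -Linf_norm_pi h => fx.
have {}fx : complex.Re `|f x| = 0 by apply/le_anti; rewrite fx abs_ge0.
by apply/normr0_eq0; rewrite ReNormE fx.
Qed.

HB.instance Definition _ := @Lmodule_isNormed.Build R[i] Linf
  (fun q => (Linf_norm q)%:C) Linf_normD Linf_normZ Linf_norm_eq0.

End Linf.

(* Main.v *)
(* Take X = Y = l_oo(N) and i = j, so that x |-> [(x, - x)] embeds X / Z into the
   amalgamated sum; it thus suffices to find Z such that X / Z is not completely
   isomorphic to a minimal operator space.  Split N into the cubes {-1,1}^n and
   let Z be the functions whose n Rademacher coefficients on each {-1,1}^n
   vanish.  Riesz products lift every a in l2^n to a function on {-1,1}^n with
   coefficients a and sup norm at most C |a|, so a |-> [sum_i a_i eps_i] is a map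
   from l2 to X / Z bounded independently of n.  Give l2 its row structure: the
   column (e_1, ..., e_n)^T has norm at most 1 there, whereas any lift of its
   image has norm at least sqrt n because each of its entries has a coefficient
   equal to 1.  If X / Z were completely isomorphic to a minimal space, these
   uniformly bounded maps would be uniformly completely bounded. *)
Require Import Defs.
From HB Require Import structures.
From mathcomp Require Import all_boot all_order all_algebra.
From mathcomp Require Import sesquilinear complex.
From mathcomp Require Import all_classical all_reals all_analysis.
From mathcomp Require Import measurable_realfun ess_sup_inf finmap ring.

Set Implicit Arguments.
Unset Strict Implicit.
Unset Printing Implicit Defensive.
Import Order.TTheory GRing.Theory Num.Def Num.Theory.
Import numFieldNormedType.Exports.
Local Open Scope classical_set_scope.
Local Open Scope complex_scope.
Local Open Scope ring_scope.

(** * Finite sums, moduli, and matrices of operators *)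

(** The obstacle is the uniform bound from l2: the function sum_i a_i eps_i can have sup norm sqrt n
    |a|, so it is a bad representative of its class. Prescribing only its n coefficients leaves room
    for a better one: with imaginary amplitudes i b_j, b real, a Riesz product has modulus at most
    exp(|b|^2 / 2), and b enters its coefficients linearly. The lift so obtained is not linear in a,
    but only the class has to be. What the quotient gains for single vectors it cannot gain for
    columns: a function on the cube with a normalised coefficient 1 has mean square at least 1, so
    for a column (f_1, ..., f_n) of lifts the mean of sum_i |f_i|^2 is at least n, and so is its
    value at some point. The row structure makes the column of basis vectors cheap; in the column
    structure of l2 it would already have norm sqrt n, and no contradiction would arise. All cubes
    sit in one space because the constants of a complete isomorphism are fixed before n is
    chosen. *)

Section finite_sums.
Context {R : realType} {I : finType}.
Implicit Types a b : I -> R.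

Lemma sum_sqr_ge0 a : 0 <= \sum_i a i ^+ 2.
Proof. by apply: sumr_ge0 => i _; exact: sqr_ge0. Qed.

Lemma sum_sqr_eq0 a : \sum_i a i ^+ 2 = 0 -> forall i, a i = 0.
Proof.
move=> /eqP; rewrite psumr_eq0 => [/allP h i|i _]; last exact: sqr_ge0.
by have := h i (mem_index_enum i); rewrite /= sqrf_eq0 => /eqP.
Qed.

(** Up to a factor, the vector M a - P b is the component of b orthogonal to a; its squared norm
    equals P (P Q - M^2), which is therefore nonnegative. *)
Lemma cauchy_schwarz_sqr a b :
  (\sum_i a i * b i) ^+ 2 <= (\sum_i a i ^+ 2) * (\sum_i b i ^+ 2).
Proof.
set M := \sum_i a i * b i; set P := \sum_i a i ^+ 2; set Q := \sum_i b i ^+ 2.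
have P0 : 0 <= P by exact: sum_sqr_ge0.
have h : 0 <= P * (P * Q - M ^+ 2).
  rewrite (_ : P * _ = \sum_i (M * a i - P * b i) ^+ 2); first exact: sum_sqr_ge0.
  transitivity (M ^+ 2 * P - 2 * M * P * M + P ^+ 2 * Q); first by clearbody M P Q; ring.
  rewrite [X in X - _ + _]mulr_sumr [X in _ - X + _]mulr_sumr [X in _ + X]mulr_sumr.
  by rewrite -sumrB -big_split /=; apply: eq_bigr => i _; ring.
move: P0; rewrite le_eqVlt => /predU1P[P0|P0].
  rewrite -P0 mul0r /M big1 ?expr0n // => i _.
  by rewrite (sum_sqr_eq0 (esym P0)) mul0r.
by rewrite -subr_ge0 -(pmulr_rge0 _ P0).
Qed.

Lemma cauchy_schwarz a b :
  \sum_i a i * b i <= sqrtr (\sum_i a i ^+ 2) * sqrtr (\sum_i b i ^+ 2).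
Proof.
rewrite -sqrtrM ?sum_sqr_ge0 // (le_trans (ler_norm _)) // -sqrtr_sqr.
by rewrite ler_wsqrtr // cauchy_schwarz_sqr.
Qed.

Lemma minkowski a b :
  sqrtr (\sum_i (a i + b i) ^+ 2) <=
  sqrtr (\sum_i a i ^+ 2) + sqrtr (\sum_i b i ^+ 2).
Proof.
rewrite -ler_sqr ?nnegrE ?addr_ge0 ?sqrtr_ge0 // sqrrD !sqr_sqrtr ?sum_sqr_ge0 //.
under eq_bigr do rewrite sqrrD.
rewrite 2!big_split /= lerD2r lerD2l sumrMnl lerMn2r cauchy_schwarz orbT //.
Qed.

Lemma sqrt_sum_sqr_le a : (forall i, 0 <= a i) ->
  sqrtr (\sum_i a i ^+ 2) <= \sum_i a i.
Proof.
move=> a0; have s0 : 0 <= \sum_i a i by exact: sumr_ge0.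
rewrite -(ger0_norm s0) -sqrtr_sqr ler_wsqrtr // expr2 mulr_sumr.
apply: ler_sum => i _; rewrite expr2 ler_wpM2r //.
by rewrite (bigD1 i) //= lerDl sumr_ge0.
Qed.

End finite_sums.

Definition rnorm (R : realType) (V : normedModType R[i]) (v : V) : R :=
  complex.Re `|v|.

Section rnorm.
Context {R : realType} {V : normedModType R[i]}.
Implicit Types u v : V.

Lemma rnormE v : `|v| = (rnorm v)%:C.
Proof. by rewrite /rnorm RRe_real // ger0_real. Qed.

Lemma rnorm_ge0 v : 0 <= rnorm v.
Proof. by rewrite -lecR -rnormE; exact: normr_ge0. Qed.

Lemma rnormD u v : rnorm (u + v) <= rnorm u + rnorm v.
Proof. by rewrite -lecR rmorphD /= -!rnormE ler_normD. Qed.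

Lemma rnorm0 : rnorm (0 : V) = 0.
Proof. by rewrite /rnorm normr0. Qed.

Lemma rnorm_eq0 v : rnorm v = 0 -> v = 0.
Proof. by move=> v0; apply/normr0_eq0; rewrite rnormE v0. Qed.

Lemma rnormN v : rnorm (- v) = rnorm v.
Proof. by rewrite /rnorm normrN. Qed.

Lemma rnormB u v : rnorm (u - v) = rnorm (v - u).
Proof. by rewrite -rnormN opprB. Qed.

Lemma rnorm_sum (I : finType) (f : I -> V) :
  rnorm (\sum_i f i) <= \sum_i rnorm (f i).
Proof.
elim/big_ind2 : _ => [|x1 x2 y1 y2 h1 h2|//]; first by rewrite rnorm0.
by rewrite (le_trans (rnormD _ _)) // lerD.
Qed.

End rnorm.

Definition cabs (R : realType) (z : R[i]) : R := complex.Re `|z|.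

Section cabs.
Context {R : realType}.
Implicit Types z w : R[i].

Lemma cabsE z : `|z| = (cabs z)%:C.
Proof. by rewrite /cabs normc_def. Qed.

Lemma cabs_ge0 z : 0 <= cabs z.
Proof. by rewrite -lecR -cabsE; exact: normr_ge0. Qed.

Lemma cabsD z w : cabs (z + w) <= cabs z + cabs w.
Proof. by rewrite -lecR rmorphD /= -!cabsE ler_normD. Qed.

Lemma cabsM z w : cabs (z * w) = cabs z * cabs w.
Proof. by apply: complexI; rewrite rmorphM /= -!cabsE normrM. Qed.

Lemma cabs0 : cabs (0 : R[i]) = 0.
Proof. by rewrite /cabs normr0. Qed.

Lemma cabs1 : cabs (1 : R[i]) = 1.
Proof. by rewrite /cabs normr1. Qed.

Lemma cabsN z : cabs (- z) = cabs z.
Proof. by rewrite /cabs normrN. Qed.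

Lemma cabsB z w : cabs (z - w) = cabs (w - z).
Proof. by rewrite -cabsN opprB. Qed.

Lemma cabs_conj z : cabs (conjc z) = cabs z.
Proof. by rewrite /cabs normcJ. Qed.

Lemma cabs_eq0 z : cabs z = 0 -> z = 0.
Proof. by move=> z0; apply/normr0_eq0; rewrite cabsE z0. Qed.

Lemma cabs_real (x : R) : cabs x%:C = `|x|.
Proof. by rewrite /cabs normc_def /= expr0n /= addr0 sqrtr_sqr. Qed.

Lemma cabs_sqr z : cabs z ^+ 2 = complex.Re z ^+ 2 + complex.Im z ^+ 2.
Proof. by rewrite /cabs normc_def /= sqr_sqrtr // addr_ge0 ?sqr_ge0. Qed.

Lemma cabs_Re z : `|complex.Re z| <= cabs z.
Proof.
rewrite -ler_sqr ?nnegrE ?cabs_ge0 // -normrX ger0_norm ?sqr_ge0 // cabs_sqr.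
by rewrite lerDl sqr_ge0.
Qed.

Lemma cabs_Im z : `|complex.Im z| <= cabs z.
Proof.
rewrite -ler_sqr ?nnegrE ?cabs_ge0 // -normrX ger0_norm ?sqr_ge0 // cabs_sqr.
by rewrite lerDr sqr_ge0.
Qed.

Lemma cabs_le_ReIm z : cabs z <= `|complex.Re z| + `|complex.Im z|.
Proof.
rewrite -ler_sqr ?nnegrE ?addr_ge0 ?cabs_ge0 // cabs_sqr sqrrD !real_normK ?num_real //.
by rewrite addrAC lerDl mulrn_wge0 // mulr_ge0.
Qed.

Lemma mulc_conj z : z * conjc z = (cabs z ^+ 2)%:C.
Proof. by rewrite -sqr_normc cabsE rmorphXn. Qed.

Lemma cabs_sum (I : Type) (r : seq I) (P : pred I) (f : I -> R[i]) :
  cabs (\sum_(i <- r | P i) f i) <= \sum_(i <- r | P i) cabs (f i).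
Proof.
elim/big_ind2 : _ => [|x1 x2 y1 y2 h1 h2|//]; first by rewrite cabs0.
by rewrite (le_trans (cabsD _ _)) // lerD.
Qed.

Lemma cabs_prod (I : Type) (r : seq I) (P : pred I) (f : I -> R[i]) :
  cabs (\prod_(i <- r | P i) f i) = \prod_(i <- r | P i) cabs (f i).
Proof. by apply: (big_morph (@cabs R)); [exact: cabsM|exact: cabs1]. Qed.

End cabs.

Lemma rnormZ (R : realType) (V : normedModType R[i]) (a : R[i]) (v : V) :
  rnorm (a *: v) = cabs a * rnorm v.
Proof. by apply: complexI; rewrite rmorphM /= -cabsE -!rnormE normrZ. Qed.

(** * Norms of matrices of operators *)

Section opnorm.
Context {R : realType} {H : normedModType R[i]}.

Lemma linear_fun0 (T : H -> H) : linear T -> T 0 = 0.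
Proof. by move=> lT; have := lT (-1) 0 0; rewrite scaler0 addr0 scaleN1r addNr. Qed.

Lemma linear_funZ (T : H -> H) a h : linear T -> T (a *: h) = a *: T h.
Proof. by move=> lT; have := lT a h 0; rewrite (linear_fun0 lT) !addr0. Qed.

Definition mxapp n (T : 'M[H -> H]_n) (h : 'I_n -> H) : 'I_n -> H :=
  fun i => \sum_j T i j (h j).

Lemma l2normE n (h : 'I_n -> H) : l2norm h = sqrtr (\sum_i rnorm (h i) ^+ 2).
Proof. by []. Qed.

Lemma l2norm_ge0 n (h : 'I_n -> H) : 0 <= l2norm h.
Proof. exact: sqrtr_ge0. Qed.

Lemma l2norm_sqr n (h : 'I_n -> H) : l2norm h ^+ 2 = \sum_i rnorm (h i) ^+ 2.
Proof. by rewrite l2normE sqr_sqrtr ?sum_sqr_ge0. Qed.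

Lemma l2norm0 n : l2norm (fun _ : 'I_n => 0 : H) = 0.
Proof.
by rewrite l2normE big1 ?sqrtr0 // => i _; rewrite rnorm0 expr0n.
Qed.

Lemma l2normZ n (a : R[i]) (h : 'I_n -> H) :
  l2norm (fun i => a *: h i) = cabs a * l2norm h.
Proof.
rewrite !l2normE -[cabs a]ger0_norm ?cabs_ge0 // -sqrtr_sqr -sqrtrM ?sqr_ge0 //.
by rewrite mulr_sumr; congr sqrtr; apply: eq_bigr => i _; rewrite rnormZ exprMn.
Qed.

Lemma rnorm_le_l2norm n (h : 'I_n -> H) i : rnorm (h i) <= l2norm h.
Proof.
rewrite l2normE -[leLHS]ger0_norm ?rnorm_ge0 // -sqrtr_sqr ler_wsqrtr //.
by rewrite (bigD1 i) //= lerDl sumr_ge0 // => j _; rewrite sqr_ge0.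
Qed.

Lemma l2norm_le_sum n (h : 'I_n -> H) : l2norm h <= \sum_i rnorm (h i).
Proof. by apply: sqrt_sum_sqr_le => i; exact: rnorm_ge0. Qed.

Lemma l2norm_eq0 n (h : 'I_n -> H) : l2norm h = 0 -> forall i, h i = 0.
Proof.
move=> h0 i; apply: rnorm_eq0; apply/eqP.
by rewrite eq_le rnorm_ge0 andbT -h0 rnorm_le_l2norm.
Qed.

Lemma l2norm1 (h : 'I_1 -> H) : l2norm h = rnorm (h ord0).
Proof. by rewrite l2normE big_ord1 sqrtr_sqr ger0_norm ?rnorm_ge0. Qed.

Lemma bounded_operatorP (T : H -> H) : bounded_operator T <->
  linear T /\ exists2 c : R, 0 <= c & forall h, rnorm (T h) <= c * rnorm h.
Proof.
split=> -[lT].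
  move=> [C hC]; split => //; exists (cabs C); first exact: cabs_ge0.
  move=> h; rewrite -lecR rmorphM /= -!rnormE -cabsE.
  have -> : `|C| * `|h| = `|C * `|h| | by rewrite normrM normr_id.
  by rewrite (le_trans (hC h)) // real_ler_norm // (ger0_real (le_trans _ (hC h))).
move=> [c c0 hc]; split => //; exists c%:C => h.
by rewrite !rnormE -rmorphM lecR.
Qed.

Lemma bounded_operatorB (S T : H -> H) : bounded_operator S ->
  bounded_operator T -> bounded_operator (S - T).
Proof.
move=> /bounded_operatorP[lS [c c0 hc]] /bounded_operatorP[lT [d d0 hd]].
apply/bounded_operatorP; split.
  move=> a x y; rewrite -[LHS]/(S (a *: x + y) - T (a *: x + y)).
  rewrite -[(S - T) x]/(S x - T x) -[(S - T) y]/(S y - T y) lS lT.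
  by rewrite opprD addrACA scalerBr.
exists (c + d); first exact: addr_ge0.
move=> h; rewrite -[(S - T) h]/(S h - T h) (le_trans (rnormD _ _)) // rnormN mulrDl.
exact: lerD.
Qed.

Definition opset n (T : 'M[H -> H]_n) : set R :=
  [set l2norm (fun i => \sum_j T i j (h j)) |
       h in [set h : 'I_n -> H | l2norm h <= 1]].

Lemma opnorm_le n (T : 'M[H -> H]_n) (c : R) : 0 <= c ->
  (forall h, l2norm (mxapp T h) <= c * l2norm h) -> opnorm T <= c.
Proof.
move=> c0 hc; apply: ge_sup.
  by exists (l2norm (mxapp T (fun=> 0))); exists (fun=> 0) => //=; rewrite l2norm0.
move=> _ [h /= h1 <-]; rewrite (le_trans (hc h)) //.
by rewrite -[leRHS]mulr1 ler_wpM2l.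
Qed.

(** Only finiteness matters, so the bounds of all entries are simply added up. Without an upper
    bound the supremum in [opnorm] would be 0 and would control nothing. *)
Lemma opset_bounded n (T : 'M[H -> H]_n) :
  (forall i j, bounded_operator (T i j)) -> has_ubound (opset T).
Proof.
move=> bT.
have /choice[c hc] : forall ij : 'I_n * 'I_n, exists c : R,
    0 <= c /\ forall h, rnorm (T ij.1 ij.2 h) <= c * rnorm h.
  move=> [i j]; have /bounded_operatorP[_ [c c0 h]] := bT i j.
  by exists c.
exists (\sum_i \sum_j c (i, j)) => _ [h /= h1 <-].
rewrite (le_trans (l2norm_le_sum _)) // ler_sum // => i _.
rewrite (le_trans (rnorm_sum _)) // ler_sum // => j _.
have [c0 hcij] := hc (i, j); rewrite (le_trans (hcij _)) //.
by rewrite -[leRHS]mulr1 ler_wpM2l // (le_trans (rnorm_le_l2norm _ _)).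
Qed.

Lemma le_opnorm n (T : 'M[H -> H]_n) (h : 'I_n -> H) :
  (forall i j, bounded_operator (T i j)) ->
  l2norm (mxapp T h) <= opnorm T * l2norm h.
Proof.
move=> bT; have [h0|h0] := eqVneq (l2norm h) 0.
  rewrite h0 mulr0 (_ : mxapp T h = fun=> 0) ?l2norm0 //.
  apply/funext => i; apply: big1 => j _; rewrite (l2norm_eq0 h0).
  by have [lT _] := bT i j; exact: linear_fun0.
have hp : 0 < l2norm h by rewrite lt_neqAle eq_sym h0 l2norm_ge0.
set t := (l2norm h)^-1%:C; have ct : cabs t = (l2norm h)^-1.
  by rewrite cabs_real ger0_norm // invr_ge0 ltW.
have : l2norm (mxapp T (fun j => t *: h j)) <= opnorm T.
  apply: ub_le_sup; first exact: opset_bounded.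
  by exists (fun j => t *: h j) => //=; rewrite l2normZ ct mulVf.
rewrite (_ : mxapp T _ = fun i => t *: mxapp T h i); last first.
  apply/funext => i; rewrite /mxapp scaler_sumr; apply: eq_bigr => j _.
  by have [lT _] := bT i j; exact: linear_funZ.
by rewrite l2normZ ct mulrC ler_pdivrMr.
Qed.

Lemma opnorm_ge0 n (T : 'M[H -> H]_n) : 0 <= opnorm T.
Proof.
have [bT|] := pselect (has_ubound (opset T)).
  apply: le_trans (l2norm_ge0 (mxapp T (fun=> 0))) (ub_le_sup bT _).
  by exists (fun=> 0) => //=; rewrite l2norm0.
(* The supremum of a set without an upper bound is 0 by convention. *)
by move=> nb; rewrite /opnorm sup_out // => -[].
Qed.

Lemma opnorm1_le (T : H -> H) (c : R) : 0 <= c ->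
  (forall h, rnorm (T h) <= c * rnorm h) ->
  opnorm (const_mx T : 'M[H -> H]_1) <= c.
Proof.
move=> c0 hc; apply: opnorm_le => // h.
by rewrite !l2norm1 /mxapp big_ord1 mxE.
Qed.

Lemma le_opnorm1 (T : H -> H) h : bounded_operator T ->
  rnorm (T h) <= opnorm (const_mx T : 'M[H -> H]_1) * rnorm h.
Proof.
move=> bT; have := @le_opnorm 1 (const_mx T) (fun=> h).
rewrite !l2norm1 /mxapp big_ord1 mxE; apply=> i j; by rewrite mxE.
Qed.

End opnorm.

(** * The Hilbert space l2 *)

Section partial_norms.
Context {R : realType}.
Implicit Types f g : nat -> R[i].

Definition pnorm N f : R := sqrtr (\sum_(k < N) cabs (f k) ^+ 2).

Lemma pnorm_ge0 N f : 0 <= pnorm N f.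
Proof. exact: sqrtr_ge0. Qed.

Lemma pnorm_sqr N f : pnorm N f ^+ 2 = \sum_(k < N) cabs (f k) ^+ 2.
Proof. by rewrite sqr_sqrtr ?sum_sqr_ge0. Qed.

Lemma pnormD N f g : pnorm N (f + g) <= pnorm N f + pnorm N g.
Proof.
apply: le_trans (minkowski _ _); rewrite ler_wsqrtr // ler_sum // => k _.
by rewrite ler_sqr ?nnegrE ?addr_ge0 ?cabs_ge0 // cabsD.
Qed.

Lemma pnormZ N (a : R[i]) f : pnorm N (a *: f) = cabs a * pnorm N f.
Proof.
rewrite /pnorm -[cabs a]ger0_norm ?cabs_ge0 // -sqrtr_sqr -sqrtrM ?sqr_ge0 //.
rewrite mulr_sumr; congr sqrtr; apply: eq_bigr => k _.
by rewrite -exprMn -cabsM.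
Qed.

Lemma pnormN N f : pnorm N (- f) = pnorm N f.
Proof. by rewrite -scaleN1r pnormZ cabsN cabs1 mul1r. Qed.

Lemma pnorm0 N : pnorm N 0 = 0.
Proof. by rewrite -(scale0r (0 : nat -> R[i])) pnormZ cabs0 mul0r. Qed.

Lemma le_pnorm M N f : (M <= N)%N -> pnorm M f <= pnorm N f.
Proof.
move=> MN; rewrite ler_wsqrtr // -!(big_mkord xpredT (fun k => cabs (f k) ^+ 2)).
rewrite (big_cat_nat (leq0n M) MN) /= lerDl sumr_ge0 // => k _.
exact: sqr_ge0.
Qed.

Lemma cabs_le_pnorm N k f : (k < N)%N -> cabs (f k) <= pnorm N f.
Proof.
move=> kN; rewrite -[leLHS]ger0_norm ?cabs_ge0 // -sqrtr_sqr ler_wsqrtr //.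
by rewrite (bigD1 (Ordinal kN)) //= lerDl sumr_ge0 // => j _; rewrite sqr_ge0.
Qed.

Lemma pnorm_le_sum N f : pnorm N f <= \sum_(k < N) cabs (f k).
Proof. by apply: sqrt_sum_sqr_le => k; exact: cabs_ge0. Qed.

End partial_norms.

Section l2.
Variable R : realType.

Definition l2_pred : {pred nat -> R[i]} :=
  [pred f | `[< exists c, forall N, pnorm N f <= c >]].

Let l2_submod_closed : submod_closed l2_pred.
Proof.
split=> [|a f g]; first by apply/asboolP; exists 0 => N; rewrite pnorm0.
move=> /asboolP[c hc] /asboolP[d hd]; apply/asboolP.
exists (cabs a * c + d) => N; rewrite (le_trans (pnormD _ _ _)) // pnormZ.
by rewrite lerD // ler_wpM2l // cabs_ge0.
Qed.
HB.instance Definition _ :=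
  GRing.isSubmodClosed.Build _ _ l2_pred l2_submod_closed.

Record l2 := L2 { l2_val :> nat -> R[i]; _ : l2_val \in l2_pred }.
HB.instance Definition _ := [isSub for l2_val].
HB.instance Definition _ := [Choice of l2 by <:].
HB.instance Definition _ := [SubChoice_isSubLmodule of l2 by <:].

Definition l2_norm (f : l2) : R := sup (range (fun N => pnorm N f)).

Let has_ub (f : l2) : has_ubound (range (fun N => pnorm N f)).
Proof.
by case: f => f /= /asboolP[c hc]; exists c => _ [N _ <-]; exact: hc.
Qed.

Lemma pnorm_le_l2_norm N (f : l2) : pnorm N f <= l2_norm f.
Proof. by apply: ub_le_sup => //; exists N. Qed.

Lemma l2_norm_le (f : l2) c : (forall N, pnorm N f <= c) -> l2_norm f <= c.
Proof.
by move=> hc; apply: ge_sup; [exists (pnorm 0 f); exists 0%N|move=> _ [N _ <-]].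
Qed.

Lemma l2_norm_ge0 (f : l2) : 0 <= l2_norm f.
Proof. exact: le_trans (pnorm_ge0 0 f) (pnorm_le_l2_norm _ _). Qed.

Lemma cabs_le_l2_norm (f : l2) k : cabs (f k) <= l2_norm f.
Proof. exact: le_trans (cabs_le_pnorm f (ltnSn k)) (pnorm_le_l2_norm _ _). Qed.

Let l2_normD (f g : l2) :
  (l2_norm (f + g))%:C <= (l2_norm f)%:C + (l2_norm g)%:C.
Proof.
rewrite -rmorphD /= lecR; apply: l2_norm_le => N.
by rewrite (le_trans (pnormD _ _ _)) // lerD // pnorm_le_l2_norm.
Qed.

Let l2_normZ_le (a : R[i]) (f : l2) : l2_norm (a *: f) <= cabs a * l2_norm f.
Proof.
apply: l2_norm_le => N; rewrite pnormZ ler_wpM2l ?cabs_ge0 //.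
exact: pnorm_le_l2_norm.
Qed.

Let l2_normZ (a : R[i]) (f : l2) : (l2_norm (a *: f))%:C = `|a| * (l2_norm f)%:C.
Proof.
rewrite cabsE -rmorphM; congr (_%:C); apply/le_anti; rewrite l2_normZ_le /=.
have [->|a0] := eqVneq a 0; first by rewrite cabs0 mul0r l2_norm_ge0.
have := l2_normZ_le a^-1 (a *: f); rewrite scalerA mulVf // scale1r => h.
apply: le_trans (ler_wpM2l (cabs_ge0 a) h) _.
by rewrite mulrA -cabsM mulfV // cabs1 mul1r.
Qed.

Let l2_norm_eq0 (f : l2) : (l2_norm f)%:C = 0 -> f = 0.
Proof.
move=> /complexI f0; apply/val_inj/funext => k; apply: cabs_eq0.
by apply/le_anti; rewrite cabs_ge0 andbT -f0 cabs_le_l2_norm.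
Qed.

HB.instance Definition _ := @Lmodule_isNormed.Build R[i] l2
  (fun f => (l2_norm f)%:C) l2_normD l2_normZ l2_norm_eq0.

Lemma pnorm_le_rnorm N (f : l2) : pnorm N f <= rnorm f.
Proof. exact: pnorm_le_l2_norm. Qed.

Lemma rnorm_l2_le (f : l2) c : (forall N, pnorm N f <= c) -> rnorm f <= c.
Proof. exact: l2_norm_le. Qed.

Lemma cabs_le_rnorm (f : l2) k : cabs (f k) <= rnorm f.
Proof. exact: cabs_le_l2_norm. Qed.

Lemma l2DE (f g : l2) k : (f + g) k = f k + g k.
Proof. by []. Qed.

Lemma l2NE (f : l2) k : (- f) k = - f k.
Proof. by []. Qed.

Lemma l2ZE a (f : l2) k : (a *: f) k = a * f k.
Proof. by []. Qed.

Lemma l2_sumE (I : finType) (F : I -> l2) k : (\sum_i F i) k = \sum_i F i k.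
Proof. by elim/big_ind2 : _ => // x1 x2 y1 y2 <- <-. Qed.

Lemma l2_ext (f g : l2) : (forall k, f k = g k) -> f = g.
Proof. by move=> fg; apply/val_inj/funext. Qed.

Lemma mkl2P (f : nat -> R[i]) c : (forall N, pnorm N f <= c) -> f \in l2_pred.
Proof. by move=> hc; apply/asboolP; exists c. Qed.

End l2.

(** * Completeness of l2 *)

Section l2_complete.
Variable R : realType.
Variables (F : set_system (l2 R)) (FF : ProperFilter F).
Hypothesis F_cauchy : forall e : R, 0 < e -> exists x, F [set y | rnorm (x - y) < e].

(** Meant for p the real and the imaginary part, so that coordinatewise convergence rests on the
    completeness of R alone. *)
Let coordinate_lim (p : R[i] -> R) : (forall z w, p (z - w) = p z - p w) ->
  (forall z, `|p z| <= cabs z) -> forall k,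
  exists l, forall e : R, 0 < e -> F [set y : l2 R | `|p (y k) - l| < e].
Proof.
move=> pB p_le k; have : cauchy ((fun y : l2 R => p (y k)) @ F).
  apply/cauchyP => /= e e0; have [x xe] := F_cauchy e0.
  exists (p (x k)); change (F [set y : l2 R | ball (p (x k)) e (p (y k))]).
  apply: filterS xe => y /= xy.
  suff : `|p (x k) - p (y k)| < e by [].
  rewrite -pB (le_lt_trans (p_le _)) // (le_lt_trans _ xy) //.
  by rewrite -l2NE -l2DE cabs_le_rnorm.
move=> /cauchy_cvg /cvg_ex[l /cvgrPdist_lt hl].
exists l => e e0; apply: filterS (hl _ e0) => y /=.
by rewrite distrC.
Qed.

Let pointwise_lim : exists h : nat -> R[i], forall k (e : R), 0 < e ->
  F [set y : l2 R | cabs (y k - h k) < e].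
Proof.
have /choice[a ha] := coordinate_lim (fun z w => raddfB (@complex.Re R) z w) (@cabs_Re R).
have /choice[b hb] := coordinate_lim (fun z w => raddfB (@complex.Im R) z w) (@cabs_Im R).
exists (fun k => Complex (a k) (b k)) => k e e0.
have e2 : 0 < e / 2 by rewrite divr_gt0.
apply: filterS2 (ha k _ e2) (hb k _ e2) => y /= hay hby.
rewrite (le_lt_trans (cabs_le_ReIm _)) // [ltRHS]splitr !raddfB /=.
exact: ltrD.
Qed.

Lemma l2_cauchy_lim : exists h : l2 R, forall e : R, 0 < e ->
  F [set y | rnorm (h - y) <= e].
Proof.
have [h hh] := pointwise_lim.
have close (e : R) x : F [set y | rnorm (x - y) < e] ->
    forall N, pnorm N (l2_val x - h) <= e.
  move=> xe N; apply/ler_addgt0Pr => d d0.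
  (* The N coordinates together then contribute at most d; [N.+1] instead of N keeps the tolerance
     positive for N = 0. *)
  have dN : 0 < d / N.+1%:R by rewrite divr_gt0.
  have Fd : F [set y : l2 R | forall k : 'I_N, cabs (y k - h k) < d / N.+1%:R].
    by apply: filter_forall => k; exact: hh.
  have [y [/= xy yh]] := filter_ex (filterI xe Fd).
  rewrite -(subrKA (l2_val y)) (le_trans (pnormD _ _ _)) // lerD //.
    by rewrite (le_trans _ (ltW xy)) // (pnorm_le_rnorm N (x - y)).
  rewrite (le_trans (pnorm_le_sum _ _)) //.
  apply: (@le_trans _ _ (\sum_(k < N) d / N.+1%:R)).
    by apply: ler_sum => k _; exact/ltW/yh.
  rewrite sumr_const card_ord -[leLHS]mulr_natr -mulrA ger_pMr // mulrC ler_pdivrMr //.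
  by rewrite mul1r ler_nat.
have [x1 hx1] := F_cauchy ltr01.
have h_l2 : h \in @l2_pred R.
  apply: (@mkl2P _ _ (rnorm x1 + 1)) => N.
  rewrite -[h](subKr (l2_val x1)) (le_trans (pnormD _ _ _)) // pnormN lerD //.
    exact: pnorm_le_rnorm.
  exact: close.
exists (L2 h_l2) => e e0; have e2 : 0 < e / 2 by rewrite divr_gt0.
have [x hx] := F_cauchy e2.
apply: filterS (hx) => y /= xy.
rewrite -(subrKA x) (le_trans (rnormD _ _)) // [leRHS]splitr lerD ?(ltW xy) //.
by rewrite rnormB; apply: rnorm_l2_le => N; exact: close hx N.
Qed.

End l2_complete.

Section l2_complete_instance.
Variable R : realType.

Let l2_complete (F : set_system (l2 R)) : ProperFilter F -> cauchy F -> cvg F.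
Proof.
move=> FF /cauchyP Fc; apply/cvg_ex.
have [|h hh] := @l2_cauchy_lim R F FF.
  move=> e e0; have [|x xe] := Fc e%:C; first by rewrite ltcR.
  exists x; apply: filterS xe => y; rewrite -ball_normE /= rnormE ltcR.
  exact.
exists h; apply/cvgrPdist_le => e e0.
have eE : e = (complex.Re e)%:C by rewrite RRe_real // gtr0_real.
have e0' : 0 < complex.Re e by rewrite -ltcR -eE.
by apply: filterS (hh _ e0') => y /= hy; rewrite rnormE eE lecR.
Qed.

HB.instance Definition _ := Uniform_isComplete.Build (l2 R) l2_complete.

End l2_complete_instance.

(** * Limits and absolutely convergent series of complex numbers *)

Section complex_limits.
Context {R : realType}.
Implicit Types (u : nat -> R[i]^o) (l : R[i]^o).

Lemma ccvgP u l : (u @ \oo --> l) <->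
  forall e : R, 0 < e -> \forall n \near \oo, cabs (l - u n) < e.
Proof.
split=> [/cvgrPdist_lt h e e0|h].
  have e0' : 0 < e%:C by rewrite ltcR.
  by apply: filterS (h _ e0') => n; rewrite cabsE ltcR.
apply/cvgrPdist_lt => e e0; have eE : e = (complex.Re e)%:C by rewrite RRe_real // gtr0_real.
have e0' : 0 < complex.Re e by rewrite -ltcR -eE.
by apply: filterS (h _ e0') => n; rewrite eE cabsE ltcR.
Qed.

Lemma ccvg_ReIm u a b :
  (fun n => complex.Re (u n)) @ \oo --> a -> (fun n => complex.Im (u n)) @ \oo --> b ->
  u @ \oo --> (Complex a b : R[i]^o).
Proof.
move=> /cvgrPdist_lt ha /cvgrPdist_lt hb; apply/ccvgP => e e0.
have e2 : 0 < e / 2 by rewrite divr_gt0.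
apply: filterS2 (ha _ e2) (hb _ e2) => n h1 h2.
rewrite (le_lt_trans (cabs_le_ReIm _)) // [ltRHS]splitr !raddfB /=.
exact: ltrD.
Qed.

Lemma ccvg_conj u l : u @ \oo --> l ->
  (fun n => conjc (u n) : R[i]^o) @ \oo --> (conjc l : R[i]^o).
Proof.
move=> /ccvgP h; apply/ccvgP => e e0; apply: filterS (h e e0) => n.
by rewrite -rmorphB cabs_conj.
Qed.

Lemma ccvg_lin (a : R[i]) u (v : nat -> R[i]^o) l (m : R[i]^o) : u @ \oo --> l -> v @ \oo --> m ->
  (fun n => a * u n + v n : R[i]^o) @ \oo --> (a * l + m : R[i]^o).
Proof.
move=> /ccvgP ul /ccvgP vm; apply/ccvgP => e e0.
have e2 : 0 < e / 2 by rewrite divr_gt0.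
have c0 : 0 < cabs a + 1 by rewrite ltr_wpDl ?cabs_ge0.
apply: filterS2 (ul _ (divr_gt0 e2 c0)) (vm _ e2) => n un vn.
have -> : a * l + m - (a * u n + v n) = a * (l - u n) + (m - v n) by ring.
rewrite (le_lt_trans (cabsD _ _)) // [ltRHS]splitr ler_ltD // cabsM.
rewrite (le_trans (ler_wpM2l (cabs_ge0 a) (ltW un))) // mulrCA ger_pMr //.
by rewrite ler_pdivrMr // mul1r lerDl.
Qed.

Lemma ccvg_cabs_le u l c : u @ \oo --> l -> (forall n, cabs (u n) <= c) -> cabs l <= c.
Proof.
move=> /ccvgP h hc; apply/ler_addgt0Pr => e e0.
have [n hn] := filter_ex (h e e0).
by rewrite -[l](subrK (u n)) addrC (le_trans (cabsD _ _)) // lerD // ltW.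
Qed.

Definition rsum (a : nat -> R) (N : nat) : R := \sum_(k < N) a k.

Definition csum u (N : nat) : R[i]^o := \sum_(k < N) u k.

Lemma abs_summable_cvg (a : nat -> R) (c : R) :
  (forall N, rsum (fun k => `|a k|) N <= c) -> cvgn (rsum a).
Proof.
have seriesE (b : nat -> R) : series b = rsum b by rewrite seriesEord.
move=> hc; rewrite -seriesE; apply: normed_cvg.
apply: nondecreasing_is_cvgn.
  by apply: nondecreasing_series => n _ _ /=.
by exists c => _ [N _ <-]; have := hc N; rewrite -seriesE.
Qed.

Lemma abs_summable_ccvg u (c : R) :
  (forall N, \sum_(k < N) cabs (u k) <= c) -> cvgn (csum u).
Proof.
move=> hc.
have hr : cvgn (rsum (fun k => complex.Re (u k))).
  apply: (@abs_summable_cvg _ c) => N; apply: le_trans (hc N).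
  by apply: ler_sum => k _; exact: cabs_Re.
have hi : cvgn (rsum (fun k => complex.Im (u k))).
  apply: (@abs_summable_cvg _ c) => N; apply: le_trans (hc N).
  by apply: ler_sum => k _; exact: cabs_Im.
apply/cvg_ex; exists (Complex (limn (rsum (fun k => complex.Re (u k))))
  (limn (rsum (fun k => complex.Im (u k))))).
apply: ccvg_ReIm.
  rewrite (_ : (fun n => _) = rsum (fun k => complex.Re (u k))) //.
  by apply/funext => N; exact: raddf_sum.
rewrite (_ : (fun n => _) = rsum (fun k => complex.Im (u k))) //.
by apply/funext => N; exact: raddf_sum.
Qed.

End complex_limits.

(** * Basis, bilinear pairing and inner product of l2 *)

Section l2_geometry.
Context {R : realType}.
Implicit Types (f g h : l2 R) (a : R[i]).

Lemma pnorm_cvg f : (fun N => pnorm N f) @ \oo --> rnorm f.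
Proof.
apply: nondecreasing_cvgn.
  by move=> M N MN; exact: le_pnorm.
by exists (rnorm f) => _ [N _ <-]; exact: pnorm_le_rnorm.
Qed.

(** The hypothesis controls only the whole sum at each level N, not its terms separately, so the
    bound is carried over by a limit in N. *)
Lemma sum_rnorm_sqr_le n (h : 'I_n -> l2 R) (c : R) :
  (forall N, \sum_i pnorm N (h i) ^+ 2 <= c) -> \sum_i rnorm (h i) ^+ 2 <= c.
Proof.
move=> hc.
have cv : (fun N => \sum_i pnorm N (h i) ^+ 2) @ \oo --> \sum_i rnorm (h i) ^+ 2.
  apply: (@cvg_big _ _ +%R) => [|i _]; first exact: add_continuous.
  by rewrite expr2; under eq_cvg do rewrite expr2; apply: cvgM; exact: pnorm_cvg.
by apply: (cvgr_to_le cv); exact: nearW.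
Qed.

Definition cutoff N (u : nat -> R[i]) : nat -> R[i] := fun k => if (k < N)%N then u k else 0.

Lemma pnorm_cutoff_le M N u : pnorm M (cutoff N u) <= pnorm N u.
Proof.
have h K : \sum_(k < K) cabs (cutoff N u k) ^+ 2 =
           \sum_(0 <= k < K | (k < N)%N) cabs (u k) ^+ 2.
  rewrite [RHS]big_mkcond big_mkord; apply: eq_bigr => k _; rewrite /cutoff.
  by case: ifP; rewrite // cabs0 expr0n.
have [MN|NM] := leqP M N.
  apply: le_trans (le_pnorm _ MN); rewrite ler_wsqrtr // ler_sum // => k _.
  rewrite /cutoff; case: ifP => // _; rewrite cabs0 expr0n sqr_ge0 //.
rewrite ler_wsqrtr // h -(big_mkord xpredT (fun k => cabs (u k) ^+ 2)).
rewrite (big_cat_nat (leq0n N) (ltnW NM)) /= [X in _ + X]big_nat_cond.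
rewrite [X in _ + X]big1 ?addr0 => [|k]; last first.
  by move=> /andP[/andP[Nk _]]; rewrite ltnNge Nk.
by rewrite big_mkcond; apply: ler_sum => k _; case: ifP => // _; exact: sqr_ge0.
Qed.

Lemma cutoff_l2 N u : cutoff N u \in @l2_pred R.
Proof. exact: mkl2P (fun M => pnorm_cutoff_le M N u). Qed.

Definition l2_cutoff N u : l2 R := L2 (cutoff_l2 N u).

Lemma rnorm_cutoff N u : rnorm (l2_cutoff N u) <= pnorm N u.
Proof. by apply: rnorm_l2_le => M; exact: pnorm_cutoff_le. Qed.

Definition l2_basis k : l2 R := l2_cutoff k.+1 (fun l => (l == k)%:R).

Lemma l2_basisE k l : l2_basis k l = (l == k)%:R.
Proof.
rewrite /l2_basis /= /cutoff; case: ifP => //; rewrite ltnS => /negbT.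
by rewrite -ltnNge => kl; rewrite gtn_eqF.
Qed.

Lemma rnorm_basis k : rnorm (l2_basis k) = 1.
Proof.
apply/le_anti; rewrite (le_trans (rnorm_cutoff _ _)) /=; last first.
  rewrite /pnorm -[leRHS]sqrtr1 ler_wsqrtr // big_ord_recr /= eqxx cabs1 expr1n.
  rewrite big1 ?add0r // => i _; by rewrite ltn_eqF // cabs0 expr0n.
by rewrite -cabs1 (_ : 1 = l2_basis k k) ?cabs_le_rnorm // l2_basisE eqxx.
Qed.

Lemma rnormZ_basis a k : rnorm (a *: l2_basis k) = cabs a.
Proof. by rewrite rnormZ rnorm_basis mulr1. Qed.

Lemma sum_cabsM_le N (u v : nat -> R[i]) :
  \sum_(k < N) cabs (u k * v k) <= pnorm N u * pnorm N v.
Proof. by under eq_bigr do rewrite cabsM; exact: cauchy_schwarz. Qed.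

Definition pairing_sum f g : nat -> R[i]^o := csum (fun k => f k * g k).

Lemma sum_cabsM_le_rnorm N f g :
  \sum_(k < N) cabs (f k * g k) <= rnorm f * rnorm g.
Proof.
apply: le_trans (sum_cabsM_le _ _ _) _.
by rewrite ler_pM ?pnorm_ge0 ?pnorm_le_rnorm.
Qed.

(** Bilinear, without conjugation, so that the row operator of a depends complex linearly on a; the
    inner product is derived from it through [l2_conj]. *)
Definition pairing f g : R[i] := limn (pairing_sum f g).

Lemma pairing_cvg f g : pairing_sum f g @ \oo --> (pairing f g : R[i]^o).
Proof.
exact: (abs_summable_ccvg (fun N => sum_cabsM_le_rnorm N f g)).
Qed.

Lemma pairing_unique f g (l : R[i]^o) : pairing_sum f g @ \oo --> l -> pairing f g = l.
Proof. by move=> h; apply: (@cvg_lim R[i]^o _ _ _ _ _ _ h). Qed.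

Lemma pairingC f g : pairing f g = pairing g f.
Proof.
rewrite /pairing (_ : pairing_sum f g = pairing_sum g f) //.
by apply/funext => N; apply: eq_bigr => k _; exact: mulrC.
Qed.

Lemma pairing_linearr f a g h : pairing f (a *: g + h) = a * pairing f g + pairing f h.
Proof.
apply: pairing_unique.
rewrite (_ : pairing_sum f _ = fun N => a * pairing_sum f g N + pairing_sum f h N).
  by apply: ccvg_lin; exact: pairing_cvg.
apply/funext => N; rewrite /pairing_sum /csum mulr_sumr -big_split.
by apply: eq_bigr => k _; rewrite l2DE l2ZE /=; ring.
Qed.

Lemma pairing_linearl f a g h : pairing (a *: g + h) f = a * pairing g f + pairing h f.
Proof. by rewrite !(pairingC _ f) pairing_linearr. Qed.

Lemma cabs_pairing f g : cabs (pairing f g) <= rnorm f * rnorm g.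
Proof.
apply: (ccvg_cabs_le (@pairing_cvg f g)) => N.
exact: le_trans (cabs_sum _ _ _) (sum_cabsM_le_rnorm _ _ _).
Qed.

Lemma pairing_cutoffr f N u : pairing f (l2_cutoff N u) = \sum_(k < N) f k * u k.
Proof.
apply: pairing_unique; apply: cvg_near_cst.
exists N => // M /= NM; rewrite /pairing_sum /csum.
rewrite -!(big_mkord xpredT (fun k => f k * _ k)) (big_cat_nat (leq0n N) NM) /=.
rewrite [X in _ + X]big_nat_cond [X in _ + X]big1 ?addr0 => [|k]; last first.
  by move=> /andP[/andP[Nk _] _]; rewrite /cutoff ltnNge Nk mulr0.
by rewrite !big_mkord; apply: eq_bigr => k _; rewrite /cutoff ltn_ord.
Qed.

Lemma pairing_basisl k f : pairing (l2_basis k) f = f k.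
Proof.
rewrite pairingC pairing_cutoffr big_ord_recr /= eqxx mulr1 big1 ?add0r // => i _.
by rewrite ltn_eqF // mulr0.
Qed.

Lemma conj_l2 f : (fun k => conjc (f k)) \in @l2_pred R.
Proof.
apply: (@mkl2P _ _ (rnorm f)) => N; apply: le_trans (pnorm_le_rnorm N f).
by rewrite /pnorm; under eq_bigr do rewrite cabs_conj.
Qed.

Definition l2_conj f : l2 R := L2 (conj_l2 f).

Definition l2_dot f g : R[i] := pairing f (l2_conj g).

Lemma l2_dotC f g : l2_dot f g = conjc (l2_dot g f).
Proof.
apply: pairing_unique; rewrite (_ : pairing_sum _ _ = fun N => conjc (pairing_sum g (l2_conj f) N) : R[i]^o).
  exact/ccvg_conj/pairing_cvg.
apply/funext => N; rewrite /pairing_sum /csum rmorph_sum; apply: eq_bigr => k _ /=.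
by rewrite rmorphM /= conjcK mulrC.
Qed.

Lemma l2_dotE f : l2_dot f f = `|f| ^+ 2.
Proof.
rewrite rnormE -rmorphXn /=; apply: pairing_unique.
rewrite (_ : pairing_sum _ _ = fun N => (pnorm N f ^+ 2)%:C : R[i]^o).
  apply/ccvgP => e e0.
  have : (fun N => pnorm N f ^+ 2) @ \oo --> rnorm f ^+ 2.
    rewrite expr2; under eq_cvg do rewrite expr2.
    by apply: cvgM; exact: pnorm_cvg.
  move=> /cvgrPdist_lt h; apply: filterS (h e e0) => N.
  by rewrite -rmorphB cabs_real.
apply/funext => N; rewrite pnorm_sqr rmorph_sum; apply: eq_bigr => k _ /=.
exact: mulc_conj.
Qed.

Let l2_dot_bilinear : bilinear_for
  (GRing.Scale.Law.clone _ _ *%R _) (GRing.Scale.Law.clone _ _ (conjC \; *%R) _) l2_dot.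
Proof.
split=> [g a x y|g a x y].
  exact: pairing_linearl.
rewrite /= ![l2_dot g _]l2_dotC /l2_dot pairing_linearl rmorphD rmorphM.
by [].
Qed.

HB.instance Definition _ := @bilinear_isBilinear.Build R[i] (l2 R) (l2 R) R[i] _ _ l2_dot
  l2_dot_bilinear.

Let l2_dot_herm (f g : l2 R) : l2_dot f g = (-1) ^+ false * conjC (l2_dot g f).
Proof. by rewrite expr0 mul1r l2_dotC. Qed.

HB.instance Definition _ := @isHermitianSesquilinear.Build R[i] (l2 R) false conjC l2_dot
  l2_dot_herm.

Let l2_dot_gt0 (f : l2 R) : f != 0 -> 0 < l2_dot f f.
Proof. by move=> f0; rewrite l2_dotE exprn_gt0 // normr_gt0. Qed.

HB.instance Definition _ := @isDotProduct.Build R[i] (l2 R) l2_dot l2_dot_gt0.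

End l2_geometry.

Lemma l2_hilbert (R : realType) : @hilbert R (l2 R) (@l2_dot R).
Proof. by move=> h; exact/esym/l2_dotE. Qed.

(** * The space L^oo of the counting measure on nat *)

Section counting_nat.
Context {R : realType}.

(** Its only null set is empty, so classes modulo null functions are functions and the essential
    supremum is the supremum. *)
Definition cnt : {measure set nat -> \bar R} := @counting nat R.

Lemma cnt_eq0 (A : set nat) : cnt A = 0%E -> A = set0.
Proof.
rewrite /cnt /= /counting; case: ifPn => // /asboolP fA [] /eqP.
rewrite pnatr_eq0 cardfs_eq0 => /eqP; exact: fset_set_set0.
Qed.

Lemma cnt_set1 k : cnt [set k] = 1%E.
Proof.
rewrite [LHS]/(counting [set k]) /counting asboolT; last exact: finite_set1.
by rewrite fset_set1 cardfs1.
Qed.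

(** Every subset of nat is measurable, so the union of a family is its essential supremum;
    singletons, of measure 1, give semifiniteness. *)
Lemma localisable_cnt : localisable cnt.
Proof.
split.
  move=> A _ Aoo; have [k Ak] : exists k, A k.
    apply/set0P/negP => /eqP A0; move: Aoo; rewrite A0 measure0; discriminate.
  exists [set k]; split => //; first by move=> _ ->.
    by rewrite cnt_set1 lte_fin ltr01.
  by rewrite cnt_set1 ltry.
move=> F _; exists (\bigcup_(A in F) A); split=> //.
  move=> A FA; rewrite (_ : A `\` _ = set0) ?measure0 //.
  by apply/seteqP; split => // k [Ak []]; exists A.
move=> G _ hG; rewrite (_ : _ `\` G = set0) ?measure0 //.
apply/seteqP; split => // k [[A FA Ak] nGk].
by have /cnt_eq0 /seteqP[+ _] := hG A FA; apply; split.
Qed.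

Lemma ae_cnt (P : nat -> Prop) : {ae cnt, forall x, P x} <-> forall x, P x.
Proof.
split=> [[A [_ /cnt_eq0 A0 PA]] x|h]; last exact: aeW.
by apply: contrapT => nP; have := PA x nP; rewrite A0.
Qed.

Lemma Linf_pi_eq (f g : ess_bounded_fun cnt) :
  Linf_pi f = Linf_pi g <-> forall k, f k = g k.
Proof.
split=> [/(proj1 (quotient_piP _ _ _)) /ae_cnt fg k|fg].
  exact/subr0_eq/fg.
apply: (proj2 (quotient_piP _ _ _)); apply/ae_cnt => k.
by rewrite -[LHS]/(f k - g k) fg subrr.
Qed.

Lemma Linf_enorm_le (f : nat -> R[i]) (c : R) : 0 <= c ->
  (Linf_enorm cnt f <= c%:E)%E <-> forall k, cabs (f k) <= c.
Proof.
move=> c0; rewrite /Linf_enorm unlock; case: ifPn => mu0.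
  rewrite -(ae_cnt (fun k => cabs (f k) <= c)).
  split=> [/ess_supP|h]; last (apply/ess_supP; move: h);
    apply: filterS => x /=; by rewrite ger0_norm ?cabs_ge0// lee_fin.
suff : (0 < cnt setT)%E by rewrite (negbTE mu0).
rewrite lt0e measure_ge0 andbT; apply/eqP => /cnt_eq0 /seteqP[+ _] => /(_ 0%N).
exact.
Qed.

Lemma Linf_norm_le (f : ess_bounded_fun cnt) (c : R) : 0 <= c ->
  rnorm (Linf_pi f) <= c <-> forall k, cabs (f k) <= c.
Proof.
move=> c0; rewrite -Linf_enorm_le //.
rewrite -[rnorm _]/(Linf_norm (Linf_pi f)) Linf_norm_pi -lee_fin fineK //.
rewrite ge0_fin_numE; last exact: Lnorm_ge0.
by have /asboolP[] := valP f.
Qed.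

Lemma ess_bounded_cnt (f : nat -> R[i]) (c : R) :
  (forall k, cabs (f k) <= c) -> f \in ess_bounded_pred cnt.
Proof.
move=> fc; apply/asboolP; split => //.
apply: (@le_lt_trans _ _ c%:E); last exact: ltry.
by apply/Linf_enorm_le => //; exact: le_trans (cabs_ge0 _) (fc 0%N).
Qed.

End counting_nat.

Section ellinf.
Context {R : realType}.

Definition ev (x : Linf (@cnt R)) (k : nat) : R[i] := ess_bounded_val (repr x) k.

Lemma ev_pi (f : ess_bounded_fun (@cnt R)) k : ev (Linf_pi f) k = f k.
Proof. by apply: (proj1 (Linf_pi_eq _ _)); exact: quotient_reprK. Qed.

Lemma Linf_piW (P : Linf (@cnt R) -> Prop) :
  (forall f, P (Linf_pi f)) -> forall x, P x.
Proof. by move=> h x; rewrite -(quotient_reprK x); exact: h. Qed.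

Lemma ev_ext (x y : Linf (@cnt R)) : (forall k, ev x k = ev y k) -> x = y.
Proof.
elim/Linf_piW: x => f; elim/Linf_piW: y => g h; apply/Linf_pi_eq => k.
by have := h k; rewrite !ev_pi.
Qed.

Lemma evP a (x y : Linf (@cnt R)) k : ev (a *: x + y) k = a * ev x k + ev y k.
Proof.
elim/Linf_piW: x => f; elim/Linf_piW: y => g.
by rewrite -linearP !ev_pi.
Qed.

Lemma evD (x y : Linf (@cnt R)) k : ev (x + y) k = ev x k + ev y k.
Proof. by rewrite -[x]scale1r evP mul1r scale1r. Qed.

Lemma ev0 k : ev 0 k = 0.
Proof. by apply: (addrI (ev 0 k)); rewrite -evD !addr0. Qed.

Lemma evZ a (x : Linf (@cnt R)) k : ev (a *: x) k = a * ev x k.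
Proof. by rewrite -[a *: x]addr0 evP ev0 addr0. Qed.

Lemma evN (x : Linf (@cnt R)) k : ev (- x) k = - ev x k.
Proof. by rewrite -scaleN1r evZ mulN1r. Qed.

Lemma evB (x y : Linf (@cnt R)) k : ev (x - y) k = ev x k - ev y k.
Proof. by rewrite evD evN. Qed.

Lemma rnorm_Linf_le (x : Linf (@cnt R)) (c : R) : 0 <= c ->
  rnorm x <= c <-> forall k, cabs (ev x k) <= c.
Proof.
elim/Linf_piW: x => f c0; rewrite Linf_norm_le //.
by split=> h k; have := h k; rewrite ev_pi.
Qed.

Lemma cabs_ev_le (x : Linf (@cnt R)) k : cabs (ev x k) <= rnorm x.
Proof. by apply: (proj1 (rnorm_Linf_le _ (rnorm_ge0 x))). Qed.

Lemma Linf_exists (f : nat -> R[i]) (c : R) : (forall k, cabs (f k) <= c) ->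
  exists x : Linf (@cnt R), ev x = f.
Proof.
move=> fc; exists (Linf_pi (EssBoundedFun (ess_bounded_cnt fc))).
by apply/funext => k; rewrite ev_pi.
Qed.

End ellinf.

(** * The minimal operator space l_oo *)

Section functionals.
Context {R : realType} {F : normedModType R[i]} {mF : matrix_norms F}.

(* Testing the functional on [sum_ij conj v_i beta_j x_ij] with
   [v = phi(x) beta] bounds [|v|^2] by [|v| (mF x) |beta|]. *)
Lemma functional_completely_contractive (phi : F -> R[i]) n (x : 'M[F]_n)
    (beta : 'I_n -> R[i]) : operator_space mF ->
  (forall a y z, phi (a *: y + z) = a * phi y + phi z) ->
  (forall y, cabs (phi y) <= rnorm y) ->
  \sum_i cabs (\sum_j phi (x i j) * beta j) ^+ 2 <=
    mF x ^+ 2 * \sum_j cabs (beta j) ^+ 2.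
Proof.
move=> [norm_mF [H [ip [J [_ bJ _ _ mFE]]]]] phi_lin phi_le.
have phi0 : phi 0 = 0.
  by have := phi_lin (-1) 0 0; rewrite scaler0 addr0 mulN1r addNr.
have phiZ a y : phi (a *: y) = a * phi y by rewrite -[a *: y]addr0 phi_lin phi0 addr0.
have phi_sum (I : finType) (f : I -> F) : phi (\sum_i f i) = \sum_i phi (f i).
  by apply: (big_morph phi) => // y z; rewrite -[y]scale1r phi_lin mul1r scale1r.
pose v i := \sum_j phi (x i j) * beta j.
rewrite -/(v _); set V2 := \sum_i _ ^+ 2; set B2 := \sum_j _ ^+ 2.
pose y := \sum_i conjc (v i) *: \sum_j beta j *: x i j.
have phiy : phi y = V2%:C.
  rewrite phi_sum rmorph_sum; apply: eq_bigr => i _ /=.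
  rewrite phiZ phi_sum -mulc_conj mulrC; congr (_ * _).
  by apply: eq_bigr => j _; rewrite phiZ mulrC.
have V20 : 0 <= V2 by exact: sum_sqr_ge0.
have B20 : 0 <= B2 by exact: sum_sqr_ge0.
have mF0 : 0 <= mF x by rewrite mFE opnorm_ge0.
have J_sum (I : finType) (f : I -> F) h : J (\sum_i f i) h = \sum_i J (f i) h.
  by apply: (big_morph (fun z => J z h)) => [z w|]; rewrite ?linearD ?linear0.
have JZ a z h : J (a *: z) h = a *: J z h by rewrite linearZ.
have Jy h : J y h = \sum_i conjc (v i) *: mxapp (map_mx J x) (fun j => beta j *: h) i.
  rewrite J_sum; apply: eq_bigr => i _; rewrite JZ J_sum; congr (_ *: _).
  apply: eq_bigr => j _.
  by rewrite JZ mxE (linear_funZ _ _ (proj1 (bJ (x i j)))).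
have V2_le : V2 <= sqrtr V2 * mF x * sqrtr B2.
  apply: (@le_trans _ _ (rnorm y)).
    by rewrite -(ger0_norm V20) -cabs_real -phiy.
  have -> : rnorm y = mF (const_mx y : 'M[_]_1).
    by apply: complexI; rewrite -rnormE norm_mF.
  rewrite mFE (_ : map_mx J _ = const_mx (J y)); last first.
    by apply/matrixP => i j; rewrite !mxE.
  apply: opnorm1_le => [|h]; first by rewrite !mulr_ge0 ?sqrtr_ge0.
  rewrite Jy; apply: le_trans (rnorm_sum _) _.
  under eq_bigr do rewrite rnormZ cabs_conj.
  apply: le_trans (cauchy_schwarz _ _) _.
  rewrite -!mulrA ler_wpM2l ?sqrtr_ge0 // -l2normE.
  apply: le_trans (le_opnorm _ _) _ => [i j|]; first by rewrite mxE.
  rewrite -mFE ler_wpM2l // l2normE.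
  under eq_bigr do rewrite rnormZ exprMn.
  by rewrite -mulr_suml sqrtrM // sqrtr_sqr ger0_norm ?rnorm_ge0.
have [->|V2n0] := eqVneq V2 0; first by rewrite mulr_ge0 ?sqr_ge0.
have s0 : 0 < sqrtr V2 by rewrite sqrtr_gt0 lt_neqAle eq_sym V2n0.
have : sqrtr V2 <= mF x * sqrtr B2.
  by rewrite -(ler_pM2l s0) -expr2 sqr_sqrtr // mulrA.
rewrite -ler_sqr ?nnegrE ?mulr_ge0 ?sqrtr_ge0 // exprMn !sqr_sqrtr //.
Qed.

End functionals.

Section closed_range.
Context {R : realType} {E H : normedModType R[i]} {J : {linear E -> (H -> H)}}.
Hypothesis J_le : forall x h, rnorm (J x h) <= rnorm x * rnorm h.
Hypothesis J_op : forall x, bounded_operator (J x).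

(** Reduces closedness of the range of J to guessing the preimage y, which in each application is
    read off the values of T on the basis: elements x with J x near T are near y, so T and J y
    agree. *)
Lemma approx_eq (T : H -> H) (y : E) : bounded_operator T ->
  (forall e : R, 0 < e -> exists x : E,
     opnorm (const_mx (T - J x) : 'M[H -> H]_1) < e) ->
  (forall (x : E) (e : R),
     opnorm (const_mx (T - J x) : 'M[H -> H]_1) < e -> rnorm (x - y) <= e) ->
  T = J y.
Proof.
move=> bT Tx xy; apply/funext => h; apply/subr0_eq/rnorm_eq0/le_anti.
rewrite rnorm_ge0 andbT; apply/ler_addgt0Pr => e e0; rewrite add0r.
(* With this tolerance the errors of T - J x and of J (x - y) at h are at most e / 2 each; the
   summand 1 covers h = 0. *)
have d0 : 0 < e / 2 / (rnorm h + 1) by rewrite !divr_gt0 // ltr_wpDl ?rnorm_ge0.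
have h_le : e / 2 / (rnorm h + 1) * rnorm h <= e / 2.
  rewrite -mulrA ger_pMr ?divr_gt0 // mulrC ler_pdivrMr ?ltr_wpDl ?rnorm_ge0 //.
  by rewrite mul1r lerDl.
have [x hx] := Tx _ d0.
rewrite -(subrKA (J x h)) (le_trans (rnormD _ _)) // [leRHS]splitr lerD //.
  apply: le_trans h_le; rewrite -[T h - J x h]/((T - J x) h).
  apply: le_trans (le_opnorm1 _ _) _; first exact: bounded_operatorB.
  by rewrite ler_wpM2r ?rnorm_ge0 // ltW.
apply: le_trans h_le.
have -> : J x h - J y h = J (x - y) h by rewrite linearB.
apply: le_trans (J_le _ _) _; rewrite ler_wpM2r ?rnorm_ge0 //.
exact: xy.
Qed.

End closed_range.

Section multiplication_operators.
Context {R : realType}.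
Local Notation X := (Linf (@cnt R)).
Local Notation H := (l2 R).

Lemma pnorm_mul_le (x : X) (h : nat -> R[i]) N :
  pnorm N (fun k => ev x k * h k) <= rnorm x * pnorm N h.
Proof.
rewrite -[rnorm x]ger0_norm ?rnorm_ge0 // -sqrtr_sqr -sqrtrM ?sqr_ge0 //.
rewrite ler_wsqrtr // mulr_sumr ler_sum // => k _.
rewrite -exprMn ler_sqr ?nnegrE ?mulr_ge0 ?rnorm_ge0 ?cabs_ge0 // cabsM.
by rewrite ler_wpM2r ?cabs_ge0 ?cabs_ev_le.
Qed.

Lemma mulop_l2 (x : X) (h : H) : (fun k => ev x k * h k) \in @l2_pred R.
Proof.
apply: (@mkl2P _ _ (rnorm x * rnorm h)) => N.
by rewrite (le_trans (pnorm_mul_le _ _ _)) // ler_wpM2l ?rnorm_ge0 ?pnorm_le_rnorm.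
Qed.

Definition mulop (x : X) : H -> H := fun h => L2 (mulop_l2 x h).

Lemma mulopE x h k : mulop x h k = ev x k * h k.
Proof. by []. Qed.

Let mulop_linear : linear mulop.
Proof.
move=> a x y; apply/funext => h; apply: l2_ext => k.
rewrite -[(a *: mulop x + mulop y) h]/(a *: mulop x h + mulop y h).
by rewrite l2DE l2ZE !mulopE evP; ring.
Qed.
HB.instance Definition _ := GRing.isLinear.Build R[i] X (H -> H) _ mulop mulop_linear.

Lemma rnorm_mulop x h : rnorm (mulop x h) <= rnorm x * rnorm h.
Proof.
apply: rnorm_l2_le => N.
by rewrite (le_trans (pnorm_mul_le _ _ _)) // ler_wpM2l ?rnorm_ge0 ?pnorm_le_rnorm.
Qed.

Lemma mulop_bounded x : bounded_operator (mulop x).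
Proof.
apply/bounded_operatorP; split; last by exists (rnorm x); [exact: rnorm_ge0|exact: rnorm_mulop].
by move=> a g h; apply: l2_ext => k; rewrite l2DE l2ZE !mulopE l2DE l2ZE; ring.
Qed.

Lemma mulop_basis x k : mulop x (l2_basis k) = ev x k *: l2_basis k.
Proof.
apply: l2_ext => l; rewrite mulopE l2ZE l2_basisE.
by case: eqP => [->|_]; rewrite ?mulr0.
Qed.

Definition linf_norms : matrix_norms X := fun n x => opnorm (map_mx mulop x).

Lemma linf_norms_ge0 n (x : 'M[X]_n) : 0 <= linf_norms x.
Proof. exact: opnorm_ge0. Qed.

(** Multiplication operators are simultaneously diagonal, so H^n splits over the coordinates k into
    copies of C^n, on which x acts as the scalar matrix with entries [ev (x i j) k]. A bound for
    these blocks uniform in k is a bound for x. *)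
Lemma linf_norms_le n (x : 'M[X]_n) (c : R) : 0 <= c ->
  (forall k (beta : 'I_n -> R[i]),
    \sum_i cabs (\sum_j ev (x i j) k * beta j) ^+ 2 <=
      c ^+ 2 * \sum_j cabs (beta j) ^+ 2) ->
  linf_norms x <= c.
Proof.
move=> c0 hc; apply: opnorm_le => // h.
rewrite -ler_sqr ?nnegrE ?mulr_ge0 ?l2norm_ge0 // exprMn !l2norm_sqr.
apply: sum_rnorm_sqr_le => N.
under eq_bigr do rewrite pnorm_sqr.
rewrite exchange_big /=.
apply: (@le_trans _ _ (\sum_(k < N) c ^+ 2 * \sum_j cabs (h j k) ^+ 2)).
  apply: ler_sum => k _; apply: le_trans (hc k (fun j => h j k)).
  rewrite le_eqVlt; apply/orP; left; apply/eqP; apply: eq_bigr => i _.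
  by rewrite l2_sumE; congr (cabs _ ^+ 2); apply: eq_bigr => j _; rewrite mxE mulopE.
rewrite -mulr_sumr ler_wpM2l ?sqr_ge0 // exchange_big ler_sum // => j _.
by rewrite -pnorm_sqr ler_sqr ?nnegrE ?pnorm_ge0 ?rnorm_ge0 // pnorm_le_rnorm.
Qed.

(** Each scalar block is a restriction of the operator, to the vectors supported at the coordinate
    k. *)
Lemma le_linf_norms n (x : 'M[X]_n) k (beta : 'I_n -> R[i]) :
  \sum_i cabs (\sum_j ev (x i j) k * beta j) ^+ 2 <=
    linf_norms x ^+ 2 * \sum_j cabs (beta j) ^+ 2.
Proof.
have := @le_opnorm R H n (map_mx mulop x) (fun j => beta j *: l2_basis k).
rewrite -ler_sqr ?nnegrE ?mulr_ge0 ?l2norm_ge0 ?opnorm_ge0 // exprMn !l2norm_sqr.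
under [\sum_i rnorm (_ *: _) ^+ 2]eq_bigr do rewrite rnormZ_basis.
move=> /(_ (fun i j => _)) h; apply: le_trans (h _) => [|i j]; last first.
  by rewrite mxE; exact: mulop_bounded.
rewrite le_eqVlt; apply/orP; left; apply/eqP; apply: eq_bigr => i _.
rewrite -(rnormZ_basis _ k) scaler_suml /mxapp; congr (rnorm _ ^+ 2).
apply: eq_bigr => j _; rewrite mxE (linear_funZ _ _ (proj1 (mulop_bounded _))).
by rewrite mulop_basis scalerA mulrC.
Qed.

Lemma map_const_mx (U V : Type) (f : U -> V) (m n : nat) (u : U) :
  map_mx f (const_mx u) = const_mx (f u) :> 'M[V]_(m, n).
Proof. by apply/matrixP => i j; rewrite !mxE. Qed.

Lemma opnorm_mulop x : opnorm (const_mx (mulop x) : 'M[_]_1) = rnorm x.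
Proof.
apply/le_anti; rewrite opnorm1_le ?rnorm_ge0 //=; last exact: rnorm_mulop.
apply/rnorm_Linf_le => [|k]; first exact: opnorm_ge0.
have := le_opnorm1 (l2_basis k) (mulop_bounded x).
by rewrite mulop_basis rnormZ_basis rnorm_basis mulr1.
Qed.

Lemma linf_norms1 x : `|x| = (linf_norms (const_mx x : 'M[_]_1))%:C.
Proof. by rewrite /linf_norms map_const_mx opnorm_mulop rnormE. Qed.

Lemma mulop_inj : injective mulop.
Proof.
move=> x y xy; apply/subr0_eq/rnorm_eq0; rewrite -opnorm_mulop linearB /= xy subrr.
apply/le_anti; rewrite opnorm_ge0 andbT; apply: opnorm1_le => // h.
by rewrite mul0r le_eqVlt (@rnorm0 R H : rnorm ((0 : H -> H) h) = 0) eqxx.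
Qed.

(** The predicate P lets one argument serve both l_oo and its subspace [flat]: the approximants of T
    in P also approximate the preimage, so a closed P contains it. *)
Lemma mulop_closed (T : H -> H) (P : X -> Prop) : bounded_operator T ->
  (forall e : R, 0 < e -> exists2 x : X, P x &
     opnorm (const_mx (T - mulop x) : 'M[H -> H]_1) < e) ->
  exists2 y : X, T = mulop y &
    forall e : R, 0 < e -> exists2 x : X, P x & rnorm (x - y) <= e.
Proof.
(* The diagonal of T is the only candidate. One approximant suffices to see that it is bounded. *)
move=> bT Tx; pose t k := T (l2_basis k) k.
have xt x e k : opnorm (const_mx (T - mulop x) : 'M[H -> H]_1) < e ->
    cabs (ev x k - t k) <= e.
  move=> Txe; rewrite cabsB.
  have -> : t k - ev x k = (T - mulop x) (l2_basis k) k.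
    rewrite -[(T - mulop x) _]/(T (l2_basis k) - mulop x (l2_basis k)).
    by rewrite l2DE l2NE mulop_basis l2ZE l2_basisE eqxx mulr1.
  apply: le_trans (cabs_le_rnorm _ _) _.
  apply: le_trans (le_opnorm1 _ _) _; first exact/bounded_operatorB/mulop_bounded.
  by rewrite rnorm_basis mulr1 ltW.
have [x1 _ hx1] := Tx 1 ltr01.
have [y yt] : exists y : X, ev y = t.
  apply: (@Linf_exists _ _ (rnorm x1 + 1)) => k.
  rewrite -[t k](subKr (ev x1 k)) (le_trans (cabsD _ _)) // cabsN lerD ?cabs_ev_le //.
  exact: xt.
have xy x e : opnorm (const_mx (T - mulop x) : 'M[H -> H]_1) < e -> rnorm (x - y) <= e.
  move=> Txe; apply/rnorm_Linf_le => [|k]; last by rewrite evB yt xt.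
  exact: le_trans (opnorm_ge0 _) (ltW Txe).
exists y; last by move=> e /Tx[x Px hx]; exists x => //; exact: xy.
apply: (@approx_eq R X H) => //; first exact: rnorm_mulop.
- exact: mulop_bounded.
- by move=> e /Tx[x _ hx]; exists x.
Qed.

Lemma linf_norms_operator_space : operator_space linf_norms.
Proof.
split; first exact: linf_norms1.
exists H, (@l2_dot R), mulop; split => //.
- exact: l2_hilbert.
- exact: mulop_bounded.
- exact: mulop_inj.
- move=> T bT Tx; have [|y Ty _] := @mulop_closed T (fun=> True) bT.
    by move=> e /Tx[x hx]; exists x.
  by exists y.
Qed.

(** The matrix norms of l_oo are tested by the evaluations at the points k; composed with a
    contraction these are contractive functionals, and contractive functionals are completely
    contractive. *)
Lemma linf_norms_minimal : minimal_operator_space linf_norms.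
Proof.
split; first exact: linf_norms_operator_space.
move=> F mF osF f f_le n x.
have mF0 : 0 <= mF n x.
  by have [_ [? [? [? [_ _ _ _ ->]]]]] := osF; exact: opnorm_ge0.
apply: linf_norms_le => // k beta.
under eq_bigr do under eq_bigr do rewrite mxE.
apply: (@functional_completely_contractive R F mF (fun y => ev (f y) k)) => //.
  by move=> a y z; rewrite linearP evP.
move=> y; apply: le_trans (cabs_ev_le _ _) _.
by rewrite -lecR -!rnormE.
Qed.

End multiplication_operators.

(** * The row operator space l2 *)

Section row_space.
Context {R : realType}.
Local Notation H := (l2 R).

(** The infinite matrix whose row 0 is a and whose other rows vanish. *)
Definition rowop (a : H) : H -> H := fun h => pairing a h *: l2_basis 0.

Let rowop_linear : linear rowop.
Proof.
move=> c a b; apply/funext => h.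
rewrite -[(c *: rowop a + rowop b) h]/(c *: rowop a h + rowop b h).
by rewrite /rowop pairing_linearl scalerDl scalerA.
Qed.
HB.instance Definition _ := GRing.isLinear.Build R[i] H (H -> H) _ rowop rowop_linear.

Lemma rnorm_rowop a h : rnorm (rowop a h) = cabs (pairing a h).
Proof. exact: rnormZ_basis. Qed.

Lemma rnorm_rowop_le a h : rnorm (rowop a h) <= rnorm a * rnorm h.
Proof. by rewrite rnorm_rowop cabs_pairing. Qed.

Lemma rowop_bounded a : bounded_operator (rowop a).
Proof.
apply/bounded_operatorP; split; last by exists (rnorm a); [exact: rnorm_ge0|exact: rnorm_rowop_le].
by move=> c g h; rewrite /rowop pairing_linearr scalerDl scalerA.
Qed.

Lemma rowop_basis a k : rowop a (l2_basis k) = a k *: l2_basis 0.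
Proof. by rewrite /rowop pairingC pairing_basisl. Qed.

Definition row_norms : matrix_norms H := fun n x => opnorm (map_mx rowop x).

(* Testing on the truncations of the conjugate vector. *)
Lemma pnorm_le_functional N (d : nat -> R[i]) (D : H -> H) (c : R) : 0 <= c ->
  linear D -> (forall h, rnorm (D h) <= c * rnorm h) ->
  (forall k, D (l2_basis k) 0 = d k) -> pnorm N d <= c.
Proof.
move=> c0 lD Dc Dd; pose u k := conjc (d k).
pose h := l2_cutoff N u.
have hE : h = \sum_(k < N) u k *: l2_basis k.
  apply: l2_ext => l; rewrite l2_sumE.
  under eq_bigr do rewrite l2ZE l2_basisE.
  rewrite /h /= /cutoff; have [lN|lN] := ltnP l N.
    rewrite (bigD1 (Ordinal lN)) //= eqxx mulr1 big1 ?addr0 // => k.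
    by rewrite -val_eqE /= eq_sym => /negbTE ->; rewrite mulr0.
  by rewrite big1 // => k _; rewrite gtn_eqF ?mulr0 // (leq_trans (ltn_ord k)).
have Dh : D h 0 = (pnorm N d ^+ 2)%:C.
  have DD f g : D (f + g) = D f + D g by have := lD 1 f g; rewrite !scale1r.
  rewrite hE (big_morph D DD (linear_fun0 lD)) l2_sumE pnorm_sqr rmorph_sum.
  apply: eq_bigr => k _ /=.
  by rewrite (linear_funZ _ _ lD) l2ZE Dd mulrC mulc_conj.
have pc : pnorm N u = pnorm N d.
  by rewrite /pnorm; under eq_bigr do rewrite cabs_conj.
have : pnorm N d ^+ 2 <= c * pnorm N d.
  apply: (@le_trans _ _ (rnorm (D h))).
    by rewrite -[leLHS]ger0_norm ?sqr_ge0 // -cabs_real -Dh cabs_le_rnorm.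
  by rewrite (le_trans (Dc h)) // ler_wpM2l // -pc rnorm_cutoff.
have [->//|d0] := eqVneq (pnorm N d) 0.
by rewrite expr2 ler_pM2r // lt_neqAle eq_sym d0 pnorm_ge0.
Qed.

Lemma opnorm_rowop a : opnorm (const_mx (rowop a) : 'M[_]_1) = rnorm a.
Proof.
apply/le_anti; rewrite opnorm1_le ?rnorm_ge0 //=; last exact: rnorm_rowop_le.
apply: rnorm_l2_le => N; apply: (@pnorm_le_functional N a (rowop a)).
- exact: opnorm_ge0.
- by have [] := rowop_bounded a.
- by move=> h; apply: le_opnorm1 (rowop_bounded _).
- by move=> k; rewrite rowop_basis l2ZE l2_basisE mulr1.
Qed.

Lemma rowop_inj : injective rowop.
Proof.
move=> x y xy; apply/subr0_eq/rnorm_eq0; rewrite -opnorm_rowop linearB /= xy subrr.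
apply/le_anti; rewrite opnorm_ge0 andbT; apply: opnorm1_le => // h.
by rewrite mul0r le_eqVlt (@rnorm0 R H : rnorm ((0 : H -> H) h) = 0) eqxx.
Qed.

Lemma row_norms_operator_space : operator_space row_norms.
Proof.
split; first by move=> x; rewrite /row_norms map_const_mx opnorm_rowop rnormE.
exists H, (@l2_dot R), rowop; split => //.
- exact: l2_hilbert.
- exact: rowop_bounded.
- exact: rowop_inj.
(* A limit of row operators is determined by its row 0. Comparison with a single approximant [x1]
   shows that this row is in l2. *)
move=> T bT Tx; pose t k := T (l2_basis k) 0.
have xt (x : H) e N : opnorm (const_mx (T - rowop x) : 'M[H -> H]_1) < e ->
    pnorm N (fun k => t k - x k) <= e.
  move=> Txe; have bTx := bounded_operatorB bT (rowop_bounded x).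
  apply: (@pnorm_le_functional N _ (T - rowop x)).
  - exact: le_trans (opnorm_ge0 _) (ltW Txe).
  - exact: (proj1 bTx).
  - move=> h; apply: le_trans (le_opnorm1 _ bTx) _.
    by rewrite ler_wpM2r ?rnorm_ge0 // ltW.
  - move=> k; rewrite -[(T - rowop x) _]/(T (l2_basis k) - rowop x (l2_basis k)).
    by rewrite l2DE l2NE rowop_basis l2ZE l2_basisE mulr1.
have [x1 hx1] := Tx 1 ltr01.
have t_l2 : t \in @l2_pred R.
  apply: (@mkl2P _ _ (1 + rnorm x1)) => N.
  rewrite -[t](subrK (l2_val x1)) (le_trans (pnormD _ _ _)) // lerD //.
    exact: xt.
  exact: pnorm_le_rnorm.
exists (L2 t_l2); apply: (@approx_eq R H H) => //; first exact: rnorm_rowop_le.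
- exact: rowop_bounded.
move=> x e Txe; rewrite rnormB; apply: rnorm_l2_le => N; exact: xt.
Qed.

Lemma row_normsZ n (c : R[i]) (x : 'M[H]_n) : row_norms (map_mx ( *:%R c) x) <= cabs c * row_norms x.
Proof.
apply: opnorm_le => [|h]; first by rewrite mulr_ge0 ?cabs_ge0 ?opnorm_ge0.
have -> : mxapp (map_mx rowop (map_mx ( *:%R c) x)) h = fun i => c *: mxapp (map_mx rowop x) h i.
  apply/funext => i; rewrite /mxapp scaler_sumr; apply: eq_bigr => j _.
  by rewrite !mxE linearZ.
rewrite l2normZ -mulrA ler_wpM2l ?cabs_ge0 //.
by apply: le_opnorm => i j; rewrite mxE; exact: rowop_bounded.
Qed.

(** Matrix norms are given on square matrices only, so the column is padded with zeros; the size
    [n.+1] provides the index [ord0]. *)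
Definition column n : 'M[H]_n.+1 :=
  \matrix_(i, j) if j == ord0 then l2_basis i else 0.

(** Stacking the rows e_0, ..., e_n gives the truncation of h_0 to its first n + 1 coordinates, a
    contraction. *)
Lemma row_norms_column n : row_norms (column n) <= 1.
Proof.
apply: opnorm_le => // h; rewrite mul1r.
rewrite -ler_sqr ?nnegrE ?l2norm_ge0 // !l2norm_sqr.
apply: (@le_trans _ _ (rnorm (h ord0) ^+ 2)); last first.
  by rewrite [leRHS](bigD1 ord0) //= lerDl sumr_ge0 // => i _; rewrite sqr_ge0.
have -> : \sum_i rnorm (mxapp (map_mx rowop (column n)) h i) ^+ 2 =
    pnorm n.+1 (h ord0) ^+ 2.
  rewrite pnorm_sqr; apply: eq_bigr => i _; congr (_ ^+ 2).
  rewrite /mxapp (bigD1 ord0) //= !mxE eqxx big1 ?addr0; last first.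
    by move=> j /negbTE j0; rewrite !mxE j0 linear0.
  by rewrite rnorm_rowop pairing_basisl.
by rewrite ler_sqr ?nnegrE ?pnorm_ge0 ?rnorm_ge0 // pnorm_le_rnorm.
Qed.

End row_space.

(** * Riesz products *)

Section cube.
Context {R : realType}.

Local Notation cube n := {ffun 'I_n -> bool}.

(** The Rademacher coefficient without the factor 2^-n: a sum over the cube instead of a mean,
    whence the factors 2^n below. *)
Definition coef n (i : 'I_n) (g : cube n -> R[i]) : R[i] :=
  \sum_(s : cube n) (-1) ^+ s i * g s.

Lemma card_cube n : #|cube n| = (2 ^ n)%N.
Proof. by rewrite card_ffun card_bool card_ord. Qed.

Lemma sum_bool (F : bool -> R[i]) : \sum_b F b = F true + F false.
Proof. by rewrite big_bool. Qed.

Lemma sum_cube_prod n (G : 'I_n -> bool -> R[i]) :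
  \sum_(s : cube n) \prod_j G j (s j) = \prod_j (G j true + G j false).
Proof. by under [RHS]eq_bigr do rewrite -sum_bool; rewrite bigA_distr_bigA. Qed.

Lemma sign_mul_prod n (i : 'I_n) (s : cube n) (G : 'I_n -> bool -> R[i]) :
  (-1) ^+ s i * \prod_j G j (s j) =
  \prod_j ((if j == i then (-1) ^+ s j else 1) * G j (s j)).
Proof.
rewrite big_split /= -big_mkcond /=; congr (_ * _).
by rewrite (big_pred1 i).
Qed.

(** Sums of product functions over the cube factor over the coordinates. Both the orthogonality of
    the Rademacher functions and the coefficients of Riesz products are instances. *)
Lemma coef_prod n (i : 'I_n) (G : 'I_n -> bool -> R[i]) :
  coef i (fun s => \prod_j G j (s j)) =
  \prod_j (if j == i then G j false - G j true else G j true + G j false).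
Proof.
rewrite /coef (eq_bigr _ (fun s _ => sign_mul_prod i s G)).
rewrite (sum_cube_prod (fun j b => (if j == i then (-1) ^+ b else 1) * G j b)).
apply: eq_bigr => j _; case: eqP => _ /=; last by rewrite !mul1r.
by rewrite expr0 expr1 mul1r mulN1r addrC.
Qed.

Lemma coef_sum n (i : 'I_n) (a : 'I_n -> R[i]) :
  coef i (fun s => \sum_j a j * (-1) ^+ s j) = (2 ^ n)%:R * a i.
Proof.
rewrite /coef; under eq_bigr do rewrite mulr_sumr.
rewrite exchange_big /= (bigD1 i) //= [X in _ + X]big1 => [|j ji].
  rewrite addr0; under eq_bigr do rewrite mulrCA -expr2 sqrr_sign mulr1.
  by rewrite sumr_const card_cube mulr_natl.
under eq_bigr do rewrite mulrCA; rewrite -mulr_sumr.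
(* The function eps_j becomes a product whose factors other than the j-th are 1; the factor at i
   then contributes 1 - 1 = 0. *)
have -> : \sum_(s : cube n) (-1) ^+ s i * (-1) ^+ s j =
    coef i (fun s => \prod_k (if k == j then (-1) ^+ s k else 1)) :> R[i].
  by apply: eq_bigr => s _; rewrite -big_mkcond (big_pred1 j).
rewrite (coef_prod i (fun k b => if k == j then (-1) ^+ b else 1)).
by rewrite (bigD1 i) //= eqxx eq_sym (negbTE ji) subrr mul0r mulr0.
Qed.

(* Riesz products: the coefficient of each sign is read off the factor it
   occurs in, while the modulus is prod_j sqrt(1 + b_j^2). *)
Definition riesz n (b : 'I_n -> R) (s : cube n) : R[i] :=
  \prod_j (1 + 'i%C * (b j)%:C * (-1) ^+ s j).

Lemma coef_riesz n (i : 'I_n) (b : 'I_n -> R) :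
  coef i (riesz b) = (2 ^ n)%:R * ('i%C * (b i)%:C).
Proof.
rewrite (coef_prod i (fun j e => 1 + 'i%C * (b j)%:C * (-1) ^+ e)).
rewrite (bigD1 i) //= eqxx.
rewrite (eq_bigr (fun=> 2%:R)) => [|j /negbTE ->]; last by rewrite expr0 expr1; ring.
rewrite prodr_const cardC1 card_ord expr0 expr1.
(* The factor at i gives 2 i b_i and each of the n - 1 others gives 2; for n = 0 there is no index
   i. *)
case: n i b => [[]//|n] i b; rewrite expnS natrM natrX /=; ring.
Qed.

(** By 1 + t <= exp t, the squared modulus prod_j (1 + b_j^2) is at most exp (sum_j b_j^2) <= e. *)
Lemma cabs_riesz n (b : 'I_n -> R) s : \sum_j b j ^+ 2 <= 1 ->
  cabs (riesz b s) <= sqrtr (expR 1).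
Proof.
move=> b1; rewrite -[leLHS]ger0_norm ?cabs_ge0 // -sqrtr_sqr ler_wsqrtr //.
apply: (@le_trans _ _ (expR (\sum_j b j ^+ 2))); last by rewrite ler_expR.
rewrite cabs_prod -prodrXl expR_sum; apply: ler_prod => j _.
rewrite sqr_ge0 /= cabs_sqr; case: (s j); rewrite ?expr1 ?expr0 /= => //.
all: apply: le_trans (expR_ge1Dx _); rewrite le_eqVlt; apply/orP; left; apply/eqP.
all: ring.
Qed.

Lemma cabs_i : cabs ('i%C : R[i]) = 1.
Proof.
by apply/eqP; rewrite -(@eqrXn2 _ 2) ?cabs_ge0 // cabs_sqr /= expr0n add0r.
Qed.

(** One sqrt e for each of the two Riesz products, which carry the real and the imaginary parts of
    the coefficients. *)
Definition lift_bound : R := 2 * sqrtr (expR 1).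

Lemma lift_bound_ge0 : 0 <= lift_bound.
Proof. by rewrite mulr_ge0 ?sqrtr_ge0. Qed.

Lemma bounded_lift n (a : 'I_n -> R[i]) (t : R) : 0 <= t ->
  \sum_j cabs (a j) ^+ 2 <= t ^+ 2 ->
  exists2 g : cube n -> R[i], forall i, coef i g = (2 ^ n)%:R * a i &
    forall s, cabs (g s) <= lift_bound * t.
Proof.
move=> t0 at2; have [t00|tn0] := eqVneq t 0.
  exists (fun=> 0) => [i|s]; last by rewrite cabs0 t00 mulr0.
  have -> : a i = 0.
    apply/cabs_eq0/(@sum_sqr_eq0 _ _ (fun j => cabs (a j)))/le_anti; rewrite sum_sqr_ge0 andbT.
    by rewrite (le_trans at2) // t00 expr0n.
  by rewrite mulr0 /coef big1 // => s _; rewrite mulr0.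
pose b j := complex.Re (a j) / t; pose c j := complex.Im (a j) / t.
have tp : 0 < t ^+ 2 by rewrite exprn_gt0 // lt_neqAle eq_sym tn0.
have b1 : \sum_j b j ^+ 2 <= 1.
  under eq_bigr do rewrite exprMn exprVn.
  rewrite -mulr_suml ler_pdivrMr // mul1r (le_trans _ at2) // ler_sum // => j _.
  by rewrite cabs_sqr lerDl sqr_ge0.
have c1 : \sum_j c j ^+ 2 <= 1.
  under eq_bigr do rewrite exprMn exprVn.
  rewrite -mulr_suml ler_pdivrMr // mul1r (le_trans _ at2) // ler_sum // => j _.
  by rewrite cabs_sqr lerDr sqr_ge0.
(* A Riesz product with real amplitudes b has coefficients i b. The factor -i turns these into b,
   while those of [riesz c] supply the imaginary part i c as they are. *)
exists (fun s => t%:C * (riesz c s - 'i%C * riesz b s)) => [i|s].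
  have -> : coef i (fun s => t%:C * (riesz c s - 'i%C * riesz b s)) =
      t%:C * (coef i (riesz c) - 'i%C * coef i (riesz b)).
    rewrite /coef mulr_sumr -sumrB mulr_sumr; apply: eq_bigr => s _; ring.
  have -> : a i = t%:C * ((b i)%:C + 'i%C * (c i)%:C).
    rewrite {1}(complexE (a i)) -[complex.Re (a i)](divfK tn0).
    by rewrite -[complex.Im (a i)](divfK tn0) !rmorphM /= -/(b i) -/(c i); ring.
  rewrite !coef_riesz.
  transitivity (t%:C * (2 ^ n)%:R * ('i%C * (c i)%:C - 'i%C ^+ 2 * (b i)%:C)).
    by ring.
  by rewrite sqr_i; ring.
rewrite cabsM cabs_real ger0_norm // mulrC ler_wpM2r // (le_trans (cabsD _ _)) //.
rewrite cabsN cabsM cabs_i mul1r /lift_bound mulr_natl mulr2n.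
by rewrite lerD // cabs_riesz.
Qed.

End cube.

(** * The amalgamated sum *)

Section blocks.
Context {R : realType}.
Local Notation cube n := {ffun 'I_n -> bool}.
Local Notation X := (Linf (@cnt R)).

(* The cubes {-1,1}^n, for all n, sit disjointly inside the index set nat. *)
Definition pt n (s : cube n) : nat := choice.pickle (n, choice.pickle s).

Lemma pt_eq m n (s : cube m) (t : cube n) : pt s = pt t -> m = n.
Proof. by move=> /(pcan_inj choice.pickleK) []. Qed.

Lemma pt_inj n : injective (@pt n).
Proof. by move=> s t /(pcan_inj choice.pickleK) [] /(pcan_inj choice.pickleK). Qed.

(** Extension of g by zero outside the n-th cube; at most one term of the sum survives, since [pt]
    is injective. *)
Definition block n (g : cube n -> R[i]) (k : nat) : R[i] :=
  \sum_(s : cube n) (k == pt s)%:R * g s.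

Lemma block_pt n (g : cube n -> R[i]) s : block g (pt s) = g s.
Proof.
rewrite /block (bigD1 s) //= eqxx mul1r big1 ?addr0 // => t ts.
by rewrite (inj_eq (@pt_inj n)) eq_sym (negbTE ts) mul0r.
Qed.

Lemma block_out n (g : cube n -> R[i]) k : (forall s : cube n, k <> pt s) -> block g k = 0.
Proof. by move=> kN; rewrite /block big1 // => s _; case: eqP (kN s); rewrite ?mul0r. Qed.

Lemma cabs_block n (g : cube n -> R[i]) (c : R) : 0 <= c ->
  (forall s, cabs (g s) <= c) -> forall k, cabs (block g k) <= c.
Proof.
move=> c0 gc k; have [[s ->]|kN] := pselect (exists s : cube n, k = pt s).
  by rewrite block_pt.
by rewrite block_out ?cabs0 // => s ks; apply: kN; exists s.
Qed.

Lemma block_exists n (g : cube n -> R[i]) : exists x : X, ev x = block g.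
Proof.
apply: (@Linf_exists _ _ (\sum_s cabs (g s))) => k.
apply: cabs_block => [|s]; first by apply: sumr_ge0 => s _; exact: cabs_ge0.
by rewrite (bigD1 s) //= lerDl sumr_ge0 // => t _; exact: cabs_ge0.
Qed.

Definition bcoef n (i : 'I_n) (x : X) : R[i] := coef i (fun s => ev x (pt s)).

Lemma bcoefP n (i : 'I_n) a x y : bcoef i (a *: x + y) = a * bcoef i x + bcoef i y.
Proof.
rewrite /bcoef /coef mulr_sumr -big_split; apply: eq_bigr => s _ /=.
by rewrite evP; ring.
Qed.

Lemma bcoefB n (i : 'I_n) x y : bcoef i (x - y) = bcoef i x - bcoef i y.
Proof. by rewrite addrC -scaleN1r bcoefP mulN1r addrC. Qed.

Lemma bcoef0 n (i : 'I_n) : bcoef i 0 = 0.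
Proof. by rewrite -(subrr (0 : X)) bcoefB subrr. Qed.

Lemma cabs_bcoef n (i : 'I_n) x : cabs (bcoef i x) <= (2 ^ n)%:R * rnorm x.
Proof.
apply: le_trans (cabs_sum _ _ _) _.
apply: (@le_trans _ _ (\sum_(s : cube n) rnorm x)).
  apply: ler_sum => s _; rewrite cabsM -signr_odd.
  by case: (odd _); rewrite ?expr1 ?expr0 ?cabsN cabs1 mul1r cabs_ev_le.
by rewrite sumr_const card_cube mulr_natl.
Qed.

(** The functional [bcoef i] has norm at most 2^n, so its kernel is closed. This serves twice: for
    the closedness of Z, and for the closure in [amalgam_kernel]. *)
Lemma bcoef_approx0 n (i : 'I_n) (y : X) :
  (forall e : R, 0 < e -> exists2 x : X, bcoef i x = 0 & rnorm (x - y) <= e) ->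
  bcoef i y = 0.
Proof.
move=> h; apply/cabs_eq0/le_anti; rewrite cabs_ge0 andbT.
apply/ler_addgt0Pr => e e0; rewrite add0r.
have n0 : 0 < (2 ^ n)%:R :> R by rewrite ltr0n expn_gt0.
have [x x0 xy] := h _ (divr_gt0 e0 n0).
have -> : bcoef i y = - bcoef i (x - y) by rewrite bcoefB x0 sub0r opprK.
rewrite cabsN (le_trans (cabs_bcoef _ _)) //.
by rewrite -ler_pdivlMl // mulrC.
Qed.

Definition flat_pred : {pred X} :=
  [pred x | `[< forall n (i : 'I_n), bcoef i x = 0 >]].

Let flat_submod_closed : submod_closed flat_pred.
Proof.
split=> [|a x y]; first by apply/asboolP => n i; exact: bcoef0.
move=> /asboolP x0 /asboolP y0; apply/asboolP => n i.
by rewrite bcoefP x0 y0 mulr0 addr0.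
Qed.
HB.instance Definition _ :=
  GRing.isSubmodClosed.Build _ _ flat_pred flat_submod_closed.

Record flat := Flat { flat_val :> X; _ : flat_val \in flat_pred }.
HB.instance Definition _ := [isSub for flat_val].
HB.instance Definition _ := [Choice of flat by <:].
HB.instance Definition _ := [SubChoice_isSubLmodule of flat by <:].

Let flat_normD (x y : flat) : `|flat_val (x + y)| <= `|flat_val x| + `|flat_val y|.
Proof. exact: ler_normD. Qed.

Let flat_normZ (a : R[i]) (x : flat) : `|flat_val (a *: x)| = `|a| * `|flat_val x|.
Proof. by rewrite -normrZ. Qed.

Let flat_norm_eq0 (x : flat) : `|flat_val x| = 0 -> x = 0.
Proof. by move=> /normr0_eq0 h; apply/val_inj. Qed.

HB.instance Definition _ := @Lmodule_isNormed.Build R[i] flat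
  (fun x => `|flat_val x|) flat_normD flat_normZ flat_norm_eq0.

Let flat_val_linear : linear flat_val.
Proof. by []. Qed.
HB.instance Definition _ := GRing.isLinear.Build R[i] flat X _ flat_val flat_val_linear.

Definition flat_norms : matrix_norms flat := fun n z => linf_norms (map_mx flat_val z).

Lemma flat_norms_operator_space : operator_space flat_norms.
Proof.
split; first by move=> z; rewrite /flat_norms map_const_mx -linf_norms1.
exists (l2 R), (@l2_dot R), (mulop \o flat_val : {linear flat -> (l2 R -> l2 R)}); split.
- exact: l2_hilbert.
- by move=> z; exact: mulop_bounded.
- by move=> x y /mulop_inj /val_inj.
- move=> T bT Tz.
  have [|y Ty yz] := @mulop_closed R T (fun x => x \in flat_pred) bT.
    by move=> e /Tz[z hz]; exists (flat_val z) => //; exact: valP z.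
  have y0 : y \in flat_pred.
    apply/asboolP => n i; apply: bcoef_approx0 => e /yz[x /asboolP x0 xy].
    by exists x => //; exact: x0.
  by exists (Flat y0).
- by move=> n z; rewrite /flat_norms /linf_norms -map_mx_comp.
Qed.

End blocks.

Section amalgam.
Context {R : realType}.
Local Notation cube n := {ffun 'I_n -> bool}.
Local Notation X := (Linf (@cnt R)).
Local Notation H := (l2 R).
Local Notation incl := (@flat_val R).
Local Notation K := (amalgam_kernel incl incl).
Local Notation A := (amalgam incl incl).
Local Notation mA := (amalgam_norms incl incl (@linf_norms R) (@linf_norms R)).

(** Hence all lifts of a class share the Rademacher coefficients of their first components, which is
    all that the lower bound uses. *)
Lemma amalgam_kernel_fst (p : X * X) n (i : 'I_n) : K p -> bcoef i p.1 = 0.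
Proof.
move=> Kp; apply: bcoef_approx0 => e e0.
have [q [Sq pq]] : linear_span [set (incl z, - incl z) | z in [set: @flat R]] `&`
    (fst @^-1` (ball p.1 e%:C)) !=set0.
  apply: Kp; exists (ball p.1 e%:C, setT); last by move=> q [].
  by split=> /=; [apply: nbhsx_ballx; rewrite ltcR|exact: filterT].
exists q.1.
  (* As the span is the smallest submodule containing the generators, it suffices that the condition
     defines such a submodule. *)
  have -> // : [set q : X * X | bcoef i q.1 = 0] q.
  apply: Sq; split; last by move=> _ [z _ <-] /=; exact: (asboolP _ (valP z)).
  split=> [|x y /= x0 y0|a x /= x0]; first exact: bcoef0.
    by rewrite -[x.1]scale1r bcoefP x0 y0 mulr0 addr0.
  by rewrite -[a *: x.1]addr0 bcoefP x0 bcoef0 mulr0 addr0.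
move: pq; rewrite /= -ball_normE /= rnormE ltcR rnormB => /ltW.
by [].
Qed.

Lemma antidiagonal_kernel (x : X) : x \in @flat_pred R -> K (x, - x).
Proof.
move=> x0; apply: subset_closure => B [_ hB]; apply: hB.
by exists (Flat x0).
Qed.

Definition rademacher n (a : H) (s : cube n) : R[i] :=
  \sum_(j < n) a j * (-1) ^+ s j.

Definition rad n (a : H) : X := sval (cid (block_exists (@rademacher n a))).

Lemma ev_rad n a : ev (rad n a) = block (@rademacher n a).
Proof. by rewrite /rad; case: cid. Qed.

(** The Rademacher sum is taken as representative because it is linear in a; the Riesz lift, which
    is not, enters only as another representative of the same class. *)
Definition antirad n (a : H) : A := quotient_pi K (rad n a, - rad n a).

Let antirad_linear n : linear (@antirad n).
Proof.
move=> c a b; rewrite /antirad -linearP; congr (quotient_pi K _).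
have radP : rad n (c *: a + b) = c *: rad n a + rad n b.
  apply: ev_ext => k; rewrite evP !ev_rad /block mulr_sumr -big_split.
  apply: eq_bigr => s _ /=; rewrite mulrCA -mulrDr; congr (_ * _).
  rewrite /rademacher mulr_sumr -big_split; apply: eq_bigr => j _.
  by rewrite l2DE l2ZE /=; ring.
by rewrite radP; congr (_, _); rewrite /= opprD scalerN.
Qed.
HB.instance Definition _ n :=
  GRing.isLinear.Build R[i] H A _ (@antirad n) (@antirad_linear n).

Lemma oplus_norms_ge0 n (p : 'M[X * X]_n) : 0 <= oplus_norms (@linf_norms R) (@linf_norms R) p.
Proof. by rewrite /oplus_norms le_max; apply/orP; left; exact: linf_norms_ge0. Qed.

Lemma mA_le n (p : 'M[X * X]_n) :
  mA n (map_mx (quotient_pi K) p) <= oplus_norms (@linf_norms R) (@linf_norms R) p.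
Proof.
apply: ge_inf; last by exists p.
by exists 0 => _ [q _ <-]; exact: oplus_norms_ge0.
Qed.

Lemma le_mA n (q : 'M[A]_n) (c : R) :
  (forall p, map_mx (quotient_pi K) p = q -> c <= oplus_norms (@linf_norms R) (@linf_norms R) p) ->
  c <= mA n q.
Proof.
move=> hc; apply: lb_le_inf; last by move=> _ [p pq <-]; exact: hc.
exists (oplus_norms (@linf_norms R) (@linf_norms R) (map_mx repr q)), (map_mx repr q) => //=.
by apply/matrixP => i j; rewrite !mxE; exact: quotient_reprK.
Qed.

Lemma antirad_le n (a : H) : mA 1 (const_mx (antirad n a)) <= @lift_bound R * rnorm a.
Proof.
have [g gcoef gle] : exists2 g : cube n -> R[i],
    forall i : 'I_n, coef i g = (2 ^ n)%:R * a i &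
    forall s, cabs (g s) <= @lift_bound R * rnorm a.
  apply: (@bounded_lift R n (fun i => a i)); first exact: rnorm_ge0.
  by rewrite -pnorm_sqr ler_sqr ?nnegrE ?pnorm_ge0 ?rnorm_ge0 // pnorm_le_rnorm.
have [w wg] := block_exists g.
have wle : rnorm w <= @lift_bound R * rnorm a.
  have c0 : 0 <= @lift_bound R * rnorm a.
    by rewrite mulr_ge0 ?rnorm_ge0 // lift_bound_ge0.
  by apply/rnorm_Linf_le => // k; rewrite wg; exact: cabs_block.
have -> : const_mx (antirad n a) = map_mx (quotient_pi K) (const_mx (w, - w)) :> 'M[_]_1.
  rewrite map_const_mx; congr const_mx; apply/quotient_piP.
  have -> : (rad n a, - rad n a) - (w, - w) = (rad n a - w, - (rad n a - w)) :> X * X.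
    by congr (_, _); rewrite /= opprB opprK addrC.
  apply: antidiagonal_kernel; apply/asboolP => m i.
  (* On the n-th cube the Rademacher sum and the Riesz lift have the same coefficients; on every
     other cube both vanish. Their difference is thus in Z. *)
  rewrite bcoefB /bcoef ev_rad wg; have [mn|mn] := eqVneq m n.
    subst m; rewrite -[X in X - _]/(coef i _) -[X in _ - X]/(coef i _).
    apply/eqP; rewrite subr_eq0; apply/eqP.
    transitivity (coef i (@rademacher n a)).
      by apply: eq_bigr => s _; rewrite block_pt.
    rewrite coef_sum -gcoef; apply: eq_bigr => s _; by rewrite block_pt.
  have out (f : cube n -> R[i]) : coef i (fun s => block f (pt s)) = 0.
    rewrite /coef big1 // => s _; rewrite block_out ?mulr0 // => t /pt_eq mn'.
    by rewrite mn' eqxx in mn.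
  by rewrite !out subrr.
apply: le_trans (mA_le _) _; rewrite /oplus_norms !map_const_mx /=.
have linf_norms1E x : linf_norms (const_mx x : 'M[_]_1) = rnorm x.
  by apply: complexI; rewrite -linf_norms1 rnormE.
by rewrite !linf_norms1E rnormN maxxx.
Qed.

(** Double counting of the squares |f_i(s)|^2, f_i being the entries of the first column of a lift:
    summed over s they give at least 2^N for each i, and summed over i at most the squared norm for
    each s. *)
Lemma antirad_column n :
  Num.sqrt n.+1%:R <= mA n.+1 (map_mx (antirad n.+1) (column n)).
Proof.
apply: le_mA => p pq; rewrite /oplus_norms le_max; apply/orP; left.
set x := map_mx fst p.
rewrite -[leRHS]ger0_norm ?linf_norms_ge0 // -sqrtr_sqr ler_wsqrtr //.
set N := n.+1 in p pq x *.
pose f i s := ev (x i ord0) (@pt N s).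
have N0 : 0 < (2 ^ N)%:R :> R by rewrite ltr0n expn_gt0.
have fcoef i : coef i (f i) = (2 ^ N)%:R.
  have : K (p i ord0 - (rad N (l2_basis i), - rad N (l2_basis i))).
    apply/quotient_piP; have := congr1 (fun M : 'M[A]_N => M i ord0) pq.
    by rewrite !mxE eqxx.
  move=> /(amalgam_kernel_fst i); rewrite /= bcoefB => /subr0_eq.
  rewrite /f /x mxE -/(bcoef i _) => ->; rewrite /bcoef ev_rad.
  transitivity (coef i (@rademacher N (l2_basis i))).
    by apply: eq_bigr => s _; rewrite block_pt.
  by rewrite coef_sum l2_basisE eqxx mulr1.
have f2 i : (2 ^ N)%:R <= \sum_s cabs (f i s) ^+ 2.
  have h : (2 ^ N)%:R <= \sum_s cabs (f i s).
    rewrite -[leLHS]ger0_norm ?(ltW N0) // -cabs_real rmorph_nat -(fcoef i).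
    apply: le_trans (cabs_sum _ _ _) _; apply: ler_sum => s _; rewrite cabsM.
    by case: (s i); rewrite ?expr1 ?expr0 ?cabsN cabs1 mul1r.
  (* Against the constant 1, whose squared norm is 2^N, this yields (2^N)^2 <= 2^N sum_s
     |f_i(s)|^2. *)
  have := cauchy_schwarz_sqr (fun _ : cube N => 1) (fun s => cabs (f i s)).
  under eq_bigr do rewrite mul1r.
  under [X in X * _]eq_bigr do rewrite expr1n.
  rewrite sumr_const card_cube => cs.
  rewrite -(ler_pM2l N0); apply: le_trans cs.
  by rewrite -expr2 ler_sqr ?nnegrE ?(ltW N0) ?(le_trans (ltW N0) h).
have row s : \sum_i cabs (f i s) ^+ 2 <= linf_norms x ^+ 2.
  have := le_linf_norms x (pt s) (fun j => (j == ord0)%:R).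
  have -> : \sum_(j < N) cabs ((j == ord0)%:R : R[i]) ^+ 2 = 1.
    rewrite (bigD1 ord0) //= cabs1 expr1n big1 ?addr0 // => j /negbTE ->.
    by rewrite cabs0 expr0n.
  rewrite mulr1; congr (_ <= _); apply: eq_bigr => i _; congr (cabs _ ^+ 2).
  rewrite (bigD1 ord0) //= mulr1 big1 ?addr0 // => j /negbTE ->.
  by rewrite mulr0.
rewrite -(ler_pM2r N0) [leRHS]mulrC.
apply: (@le_trans _ _ (\sum_i \sum_s cabs (f i s) ^+ 2)).
  rewrite mulr_natl -[X in _ *+ X](card_ord N) -sumr_const.
  by apply: ler_sum => i _; exact: f2.
rewrite exchange_big /= mulr_natl -card_cube -sumr_const.
by apply: ler_sum => s _; exact: row.
Qed.

End amalgam.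

Theorem theorem1p1 (R : realType) :
  exists (d1 d2 : measure_display)
         (T1 : measurableType d1) (T2 : measurableType d2)
         (mu1 : {measure set T1 -> \bar R}) (mu2 : {measure set T2 -> \bar R}),
    localisable mu1 /\ localisable mu2 /\
    exists (mX : matrix_norms (Linf mu1)) (mY : matrix_norms (Linf mu2))
           (Z : normedModType R[i]) (mZ : matrix_norms Z)
           (i : {linear Z -> Linf mu1}) (j : {linear Z -> Linf mu2}),
      [/\ minimal_operator_space mX,
          minimal_operator_space mY,
          operator_space mZ,
          complete_isometry mZ mX i /\ complete_isometry mZ mY j &
          forall (W : normedModType R[i]) (mW : matrix_norms W),
            minimal_operator_space mW ->
            ~ completely_isomorphic (amalgam_norms i j mX mY) mW].
Proof.
exists _, _, nat, nat, cnt, cnt.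
split; [exact: localisable_cnt|split; first exact: localisable_cnt].
exists (@linf_norms R), (@linf_norms R), (@flat R), (@flat_norms R), (@flat_val R), (@flat_val R).
split; [exact: linf_norms_minimal|exact: linf_norms_minimal|exact: flat_norms_operator_space|by []|].
move=> W mW [[normW osW] minW] [f [g [fK _ [Cf hf] [Cg hg]]]].
set mA := amalgam_norms _ _ _ _ in hf hg.
have mA_ge0 n (q : 'M[_]_n) : 0 <= mA n q by apply: le_mA => p _; exact: oplus_norms_ge0.
have mW_ge0 n (w : 'M[_]_n) : 0 <= mW n w.
  by have [? [? [? [_ _ _ _ ->]]]] := osW; exact: opnorm_ge0.
(* The absolute value is taken as [Cf] carries no sign; the summand 1 makes c positive. Division by
   c turns the composite of f and [antirad] into a contraction, whatever n is. *)
pose c := `|Cf| * @lift_bound R + 1.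
have c0 : 0 < c by rewrite ltr_wpDl // mulr_ge0 ?normr_ge0 ?lift_bound_ge0.
pose B := `|Cg| * c.
have B0 : 0 <= B by rewrite mulr_ge0 // ltW.
(* Larger than B^2, so that sqrt (n + 1) exceeds the bound B that minimality will impose. *)
pose n := Num.bound (B ^+ 2).
have ck : cabs (c^-1)%:C = c^-1 by rewrite cabs_real ger0_norm // invr_ge0 ltW.
pose u : {linear l2 R -> W} := f \o (@antirad R n.+1 \o ( *:%R (c^-1)%:C)).
have u_le a : `|u a| <= `|a|.
  rewrite (rnormE a) normW lecR.
  have -> : const_mx (u a) = map_mx f (const_mx (antirad n.+1 ((c^-1)%:C *: a))) :> 'M[_]_1.
    by rewrite map_const_mx.
  apply: le_trans (hf _ _) _.
  apply: (@le_trans _ _ (`|Cf| * mA 1 (const_mx (antirad n.+1 ((c^-1)%:C *: a))))).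
    by rewrite ler_wpM2r ?mA_ge0 ?ler_norm.
  apply: (@le_trans _ _ (`|Cf| * (@lift_bound R * rnorm ((c^-1)%:C *: a)))).
    by rewrite ler_wpM2l ?normr_ge0 //; exact: antirad_le.
  rewrite rnormZ ck.
  have -> : `|Cf| * (@lift_bound R * (c^-1 * rnorm a)) =
      `|Cf| * @lift_bound R / c * rnorm a by rewrite -!mulrA.
  by rewrite ler_piMl ?rnorm_ge0 // ler_pdivrMr // mul1r lerDl.
(* Minimality makes u completely contractive on the row space. Multiplying the column by c undoes
   the division in u, so that g maps the result back to the image of the column itself. *)
have := minW _ _ (@row_norms_operator_space R) u u_le _ (map_mx ( *:%R c%:C) (@column R n)).
set y := map_mx u _ => y_le.
have cVc : (c^-1)%:C * c%:C = 1 :> R[i] by rewrite -rmorphM /= mulVf ?gt_eqF.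
have yE : y = map_mx f (map_mx (@antirad R n.+1) (column n)).
  rewrite /y -!map_mx_comp; apply/matrixP => i j; rewrite !mxE /=.
  by rewrite scalerA cVc scale1r.
have gy : map_mx g y = map_mx (@antirad R n.+1) (column n).
  by rewrite yE; apply/matrixP => i j; rewrite !mxE fK.
have : Num.sqrt n.+1%:R <= B.
  apply: le_trans (@antirad_column R n) _; rewrite -gy; apply: le_trans (hg _ _) _.
  apply: (@le_trans _ _ (`|Cg| * mW n.+1 y)); first by rewrite ler_wpM2r ?ler_norm.
  rewrite /B ler_wpM2l ?normr_ge0 //; apply: le_trans y_le _.
  apply: le_trans (row_normsZ _ _) _; rewrite cabs_real (ger0_norm (ltW c0)).
  by rewrite -[leRHS]mulr1 ler_wpM2l ?(ltW c0) // row_norms_column.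
rewrite -ler_sqr ?nnegrE ?sqrtr_ge0 // sqr_sqrtr ?ler0n // leNgt => /negP; apply.
apply: lt_le_trans (archi_boundP _) _; first exact: sqr_ge0.
by rewrite ler_nat.
Qed.
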